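(* Let $\lambda>0$ and $t\in\mathbb{R}$ be fixed, and let $\mathrm{p}(n,t)$ be the coefficient of $x^{n-1}$ in the monic orthogonal polynomial $P_n(x;t)$ of degree $n$ with respect to $w(x;t)=x^\lambda e^{-x^2+tx}$ on $(0,\infty)$. Then, as $n\to\infty$, $$\begin{aligned}\mathrm{p}(n,t)=&-\frac{2}{3}\sqrt{\frac{2}{3}}\,n^{3/2}-\frac{nt}{6}-\frac{(t^2+12\lambda)\sqrt{n}}{12\sqrt{6}}-\frac{t(t^2+18\lambda)}{216}-\frac{t^4+24\lambda t^2-288\lambda^2+48}{1152\sqrt{6n}}\\&+\frac{t(9\lambda^2-2)}{144n}+\frac{t^6+36\lambda t^4+144t^2(66\lambda^2-17)-1728\lambda(8\lambda^2-1)}{165888\sqrt{6}\,n^{3/2}}\\&+\frac{t\left[t^2(27\lambda^2-7)+12\lambda(2-9\lambda^2)\right]}{3456n^2}+O(n^{-5/2}).\end{aligned}$$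
   Context: For $\lambda>0$ and $t\in\mathbb{R}$, let $w(x;t)=x^\lambda e^{-x^2+tx}$ for $x\in(0,\infty)$. $P_n(x;t)=x^n+\mathrm{p}(n,t)x^{n-1}+\cdots+P_n(0;t)$ is the monic polynomial of degree $n$ in $x$ with $\int_0^\infty P_m(x;t)P_n(x;t)w(x;t)\,dx=h_n(t)\delta_{mn}$ for $m,n\ge 0$. *)

(* Defs.v *)
From mathcomp Require Import all_boot all_order all_algebra.
From mathcomp Require Import all_classical all_reals all_analysis.

Set Implicit Arguments.
Unset Strict Implicit.
Unset Printing Implicit Defensive.

Import Order.TTheory GRing.Theory Num.Theory.
Import numFieldNormedType.Exports.

Local Open Scope classical_set_scope.
Local Open Scope ring_scope.

Definition weight (R : realType) (lambda t x : R) : R :=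
  x `^ lambda * expR (- x ^+ 2 + t * x).

(* The orthogonality integral is the extended-real Lebesgue integral, so its
   being equal to a real number excludes an infinite value. *)
Definition monic_orthogonal (R : realType) (lambda t : R)
    (P : nat -> {poly R}) (h : nat -> R) : Prop :=
  (forall n, P n \is monic /\ size (P n) = n.+1) /\
  (forall m n : nat,
    (\int[lebesgue_measure]_(x in `]0%R, +oo[)
        ((P m).[x] * (P n).[x] * weight lambda t x)%R%:E)%E
    = (if m == n then h n else 0)%:E).

(* The coefficient of 'X^(n-1); its value at n = 0 is immaterial. *)
Definition subleading (R : realType) (P : nat -> {poly R}) (n : nat) : R :=
  (P n)`_n.-1.

(* 144 * 1152 stands for 165888: literals are unary, and that one overflows. *)
Definition subleading_expansion (R : realType) (l t : R) (n : nat) : R :=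
  let N : R := n%:R in
  - (2 / 3) * Num.sqrt (2 / 3) * N `^ (3 / 2)
  - N * t / 6
  - (t ^+ 2 + 12 * l) * Num.sqrt N / (12 * Num.sqrt 6)
  - t * (t ^+ 2 + 18 * l) / 216
  - (t ^+ 4 + 24 * l * t ^+ 2 - 288 * l ^+ 2 + 48) / (1152 * Num.sqrt (6 * N))
  + t * (9 * l ^+ 2 - 2) / (144 * N)
  + (t ^+ 6 + 36 * l * t ^+ 4 + 144 * t ^+ 2 * (66 * l ^+ 2 - 17)
       - 1728 * l * (8 * l ^+ 2 - 1)) / (144 * 1152 * Num.sqrt 6 * N `^ (3 / 2))
  + t * (t ^+ 2 * (27 * l ^+ 2 - 7) + 12 * l * (2 - 9 * l ^+ 2))
      / (3456 * N ^+ 2).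

(* Main.v *)
Require Import Defs.
From HB Require Import structures.
From mathcomp Require Import all_boot all_order all_algebra.
From mathcomp Require Import all_classical all_reals all_analysis.
From mathcomp Require Import measurable_realfun.
From mathcomp Require Import ring lra.
Import Order.TTheory GRing.Theory Num.Theory.
Import numFieldNormedType.Exports.
Local Open Scope classical_set_scope.
Local Open Scope ring_scope.

Set Implicit Arguments.
Unset Strict Implicit.
Unset Printing Implicit Defensive.


(** The substitution x = y^2 turns the polynomials P_n into the even-degree
    orthogonal polynomials S_(2n) of the even weight
    |y|^(2 lambda + 1) exp (- y^4 + t y^2) on the whole line.  Let gamma_m > 0
    be the coefficients of y S_m = S_(m+1) + gamma_m S_(m-1).  Integrating the
    derivative of S_m S_(m-1) times this weight gives Freud's equations
      4 gamma_m (gamma_(m+1) + gamma_m + gamma_(m-1) - t / 2)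
        = m + (2 lambda + 1) [m odd],
    which are [freud_even] and [freud_odd].  A third integration by parts
    writes p(n,t) as a polynomial in n, gamma_(2n) and gamma_(2n-1)
    ([subleading_gamma]); this fixes the constant term of the expansion, which
    summing the recurrence coefficients would leave undetermined.

    Freud's equations have a formal solution in powers of n^(-1/2), one series
    for each parity, and its truncations satisfy them up to a small residual
    ([expands_residual_even], [expands_residual_odd]).  The positive solution
    has to follow it.  Dropping the positive neighbours from the equation bounds
    gamma_m from above by about sqrt (m) / 2; then the bracket is so large
    that the difference d_m to the formal solution satisfies
      |d_m| <= 2/5 (|d_(m-1)| + |d_(m+1)|) + residual
    ([gap_even], [gap_odd]).  Since 2/5 + 2/5 < 1, such a sequence is either of
    the size of the residual or grows geometrically ([barrier_decay]), and the
    upper bound excludes growth.  Hence the gammas agree with six terms of the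
    formal solution up to O(n^(-5/2)).

    This precision is enough for p(n,t), although p(n,t) is of order n^(3/2) and
    cubic in the gammas, because p(n,t) is almost stationary in them: its
    partial derivatives are products of a gamma with a difference
    gamma_m - gamma_(m-2), and so stay bounded ([expands_scaled_subleading_dx],
    [expands_scaled_subleading_dy]).  What remains is the comparison of eight
    coefficients ([expands_scaled_subleading]). *)

(** * Moments of the weight and their Pearson relation *)

(** The function x p(x) w(x), where w is the weight, has derivative
    [(pearson l t p).[x] * w x] on the half-line. *)
Definition pearson (R : realFieldType) (l t : R) (p : {poly R}) : {poly R} :=
  'X * p^`() + (l + 1) *: p + t *: ('X * p) - 2 *: ('X^2 * p).

Section Moments.
Variables (R : realType) (l t : R).
Hypothesis l_gt0 : 0 < l.
Implicit Types p q : {poly R}.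
Local Notation mu := (@lebesgue_measure R).
Local Notation D := (`]0, +oo[%classic : set R).
Local Notation w := (weight l t).

Lemma weight_ge0 x : 0 <= w x.
Proof. by rewrite mulr_ge0 ?powR_ge0 ?expR_ge0. Qed.

Lemma weight_gt0 x : 0 < x -> 0 < w x.
Proof. by move=> x0; rewrite mulr_gt0 ?powR_gt0 ?expR_gt0. Qed.

Lemma exp_quadratic_le (c x : R) :
  expR (- x ^+ 2 + c * x) <= expR ((c + 1) ^+ 2) * expR (- x).
Proof.
rewrite -expRD ler_expR.
have := sqr_ge0 (x - (c + 1) / 2); have := sqr_ge0 (c + 1); rewrite !expr2; lra.
Qed.

Lemma powR_le_expR x : 0 < x -> x `^ l <= expR (l * x).
Proof.
move=> x0; rewrite /powR gt_eqF// ler_expR ler_wpM2l ?(ltW l_gt0)//.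
by rewrite ltW// ln_sublinear.
Qed.

Lemma expr_le_expR (x : R) n : 0 <= x -> x ^+ n <= expR (n%:R * x).
Proof.
move=> x0; rewrite expRM_natl lerXn2r ?nnegrE ?expR_ge0//.
by rewrite (le_trans _ (expR_ge1Dx x))// lerDr.
Qed.

(** A power of x is at most an exponential, and the Gaussian factor beats every
    exponential.  This domination gives both the integrability of the moments and
    the vanishing of boundary terms at infinity. *)
Lemma poly_weight_le p : exists2 B, 0 <= B & forall x, 0 < x -> `|p.[x] * w x| <= B * expR (- x).
Proof.
exists (\sum_(i < size p) `|p`_i| * expR ((t + l + i%:R + 1) ^+ 2)).
  by apply: sumr_ge0 => i _; rewrite mulr_ge0 ?expR_ge0.
move=> x x0; rewrite horner_coef normrM [`|w x|]ger0_norm ?weight_ge0//.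
apply: (@le_trans _ _ ((\sum_(i < size p) `|p`_i * x ^+ i|) * w x)).
  by rewrite ler_wpM2r ?weight_ge0// ler_norm_sum.
rewrite !mulr_suml ler_sum// => i _.
rewrite normrM -!mulrA ler_wpM2l// ger0_norm ?exprn_ge0 ?(ltW x0)//.
apply: le_trans (exp_quadratic_le _ _).
have -> : expR (- x ^+ 2 + (t + l + i%:R) * x) =
    expR (i%:R * x) * (expR (l * x) * expR (- x ^+ 2 + t * x)).
  by rewrite -!expRD; congr expR; ring.
rewrite ler_pM ?expr_le_expR ?exprn_ge0 ?weight_ge0 ?(ltW x0)//.
by rewrite ler_wpM2r ?expR_ge0 ?powR_le_expR.
Qed.

Lemma measurable_poly_weight p (A : set R) : measurable_fun A (fun x => p.[x] * w x).
Proof.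
apply: measurable_funM; first exact: measurable_poly.
apply: measurable_funM; first exact: measurable_funTS (measurable_powR _).
apply: (measurableT_comp (@measurable_expR R)).
by apply: measurable_funD; [apply: measurable_funN; apply: measurable_funX|apply: measurable_funM].
Qed.

Lemma integrable_expRN : mu.-integrable D (EFin \o (fun x => expR (- x))).
Proof.
have H := @integrable_exponential_pdf R 1 ltr01.
have : mu.-integrable D (EFin \o exponential_pdf 1) by apply: (integrableS _ _ _ H).
apply: eq_integrable => // x; rewrite inE/= in_itv/= andbT => x0.
by rewrite /= exponential_pdfE ?(ltW x0)// mul1r mulN1r.
Qed.

Lemma integrable_poly_weight p : mu.-integrable D (EFin \o (fun x => p.[x] * w x)).
Proof.
have [B B0 pB] := poly_weight_le p.
have H : mu.-integrable D (fun x => B%:E * (expR (- x))%:E)%E.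
  by apply: integrableZl => //; exact: integrable_expRN.
apply: le_integrable H => //.
  by apply/measurable_EFinP; exact: measurable_poly_weight.
move=> x; rewrite /= in_itv/= andbT => x0.
by rewrite lee_fin (le_trans (pB x x0))// ler_norm.
Qed.

Definition moment p : R := \int[mu]_(x in D) (p.[x] * w x).

Lemma moment_scalar : scalar moment.
Proof.
move=> k p q; rewrite /moment.
rewrite -RintegralZl//; last exact: integrable_poly_weight.
rewrite -RintegralD//; last exact: integrable_poly_weight.
  by apply: eq_Rintegral => x _; rewrite hornerD hornerZ mulrDl -mulrA.
rewrite (_ : EFin \o _ = fun x => k%:E * (p.[x] * w x)%:E)%E//.
by apply: integrableZl => //; exact: integrable_poly_weight.
Qed.

Definition moment_linear : {scalar {poly R}} :=
  HB.pack moment (GRing.isLinear.Build R {poly R} R _ moment moment_scalar).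

(** If the integral were zero, the integrand would vanish almost everywhere, and p
    would have a root in each interval ]n, n + 1[, more than its degree
    allows. *)
Lemma moment_gt0 p : p != 0 -> (forall x, 0 < x -> 0 <= p.[x]) -> 0 < moment p.
Proof.
move=> p0 pge0.
have pw0 x : D x -> 0 <= p.[x] * w x.
  by rewrite /= in_itv/= andbT => x0; rewrite mulr_ge0 ?weight_ge0// pge0.
have m0 : 0 <= moment p by apply: Rintegral_ge0.
rewrite lt_neqAle m0 andbT eq_sym; apply/eqP => mp.
have : (\int[mu]_(x in D) `|(p.[x] * w x)%:E| = 0)%E.
  transitivity (\int[mu]_(x in D) (p.[x] * w x)%:E)%E.
    by apply: eq_integral => x; rewrite inE => /pw0 h; rewrite gee0_abs.
  rewrite -[LHS]fineK; first by congr EFin.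
  exact: integrable_fin_num (integrable_poly_weight p).
move=> /(ae_eq_integral_abs mu _ _)-[] //.
  by apply/measurable_EFinP; exact: measurable_poly_weight.
move=> A [mA A0 subA].
have rootp n : exists x : R, n%:R < x < n%:R + 1 /\ root p x.
  apply: contrapT => noroot.
  pose I : set R := `]n%:R, (n%:R + 1)[%classic.
  suff : (mu I <= 0)%E.
    by rewrite /I lebesgue_measure_itv/= lte_fin ltrDl ltr01 -EFinB lee_fin
      addrAC subrr add0r ler10.
  rewrite -A0; apply: le_measure; rewrite ?inE; [exact: measurable_itv|exact: mA|].
  move=> x; rewrite /I /= in_itv/= => nx; apply: subA => /= H; apply: noroot; exists x; split => //.
  have x0 : 0 < x by case/andP: nx => nx _; exact: le_lt_trans nx.
  have Dx : D x by rewrite /= in_itv/= x0.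
  have [/eqP] := H Dx.
  by rewrite mulf_eq0 (gt_eqF (weight_gt0 x0)) orbF.
have [f Hf] := choice rootp.
have := @max_poly_roots _ p [seq f i | i <- iota 0 (size p)] p0.
rewrite size_map size_iota ltnn => /(_ _ _)/implyP.
have -> : all (root p) [seq f i | i <- iota 0 (size p)].
  by apply/allP => _ /mapP[i _ ->]; have [] := Hf i.
suff -> : uniq [seq f i | i <- iota 0 (size p)] by move=> /(_ isT isT).
rewrite map_inj_uniq ?iota_uniq// => i j fij.
have [/andP[i1 i2] _] := Hf i; have [/andP[j1 j2] _] := Hf j.
have ij : i%:R < j%:R + 1 :> R by rewrite (lt_trans i1)// fij.
have ji : j%:R < i%:R + 1 :> R by rewrite (lt_trans j1)// -fij.
by move: ij ji; rewrite !natr1 !ltr_nat !ltnS => ij ji; apply/eqP; rewrite eqn_leq ij ji.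
Qed.

Local Notation g p := (fun x => p.[x] * w x).

Lemma is_derive_weight (x : R) : 0 < x ->
  is_derive x 1 w ((l + t * x - 2 * x ^+ 2) / x * w x).
Proof.
move=> x0.
have d1 := is_derive1_powR l x0.
have d2 : is_derive x 1 (fun x => - x ^+ 2 + t * x) (- 2 * x + t).
  apply: is_derive_eq; rewrite /GRing.scale/=; ring.
have d3 := is_derive1_comp (is_derive_expR _) d2.
have d := is_deriveM d1 d3.
apply: (@is_derive_eq _ _ _ _ _ _ _ _ d) => /=.
have -> : x `^ (l - 1) = x `^ l / x.
  rewrite powRB; first by rewrite powRr1// ltW.
  by rewrite (gt_eqF x0) implybT.
by rewrite /weight /GRing.scale/=; field; rewrite gt_eqF.
Qed.

Lemma is_derive_XpW p (x : R) : 0 < x -> is_derive x 1 (g ('X * p)) ((pearson l t p).[x] * w x).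
Proof.
move=> x0.
have d1 : is_derive x 1 (horner ('X * p)) (('X * p)^`()).[x].
  by rewrite derivE derive1E; apply: derivableP; exact: derivable_horner.
have d := is_deriveM d1 (is_derive_weight x0).
apply: (@is_derive_eq _ _ _ _ _ _ _ _ d) => /=.
rewrite derivM derivX /pearson !(hornerE, hornerM) /GRing.scale/= /weight.
by field; rewrite gt_eqF.
Qed.

Lemma continuous_poly_weight p (x : R) : 0 < x -> {for x, continuous (g p)}.
Proof.
move=> x0; apply: continuousM; first exact: continuous_horner.
by apply: differentiable_continuous; apply/derivable1_diffP; have [] := is_derive_weight x0.
Qed.

Lemma weight0 : w 0 = 0.
Proof. by rewrite /weight powR0 ?mul0r// gt_eqF. Qed.

Lemma poly_weight_cvg0 p : g p x @[x --> 0^'+] --> g p 0.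
Proof.
have -> : p.[0] * w 0 = p.[0] * (0 * expR (- 0 ^+ 2 + t * 0)) by rewrite weight0 mul0r.
apply: cvgM; first by apply: cvg_at_right_filter; exact: continuous_horner.
apply: cvgM; first exact: powR_cvg0.
apply: cvg_at_right_filter.
have cq : {for (0 : R), continuous (fun x : R => - x ^+ 2 + t * x)}.
  by apply: differentiable_continuous; apply/derivable1_diffP; exact: ex_derive.
exact: (continuous_comp cq (@continuous_expR R _)).
Qed.

(** The summand [B * expR (- x)] makes the integrand nonnegative, so that its
    integral over the half-line is the total increment of its primitive.  The
    factor x kills the primitive of the first summand at 0. *)
Lemma integral_pearson_shift p B :
  (forall x, 0 <= x -> 0 <= (pearson l t p).[x] * w x + B * expR (- x)) ->
  \int[mu]_(x in `[0, +oo[) ((pearson l t p).[x] * w x + B * expR (- x)) = B.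
Proof.
move=> pos.
pose F x := g ('X * p) x - B * expR (- x).
have dexp (x : R) : is_derive x 1 (fun x => B * expR (- x)) (- (B * expR (- x))).
  apply: is_derive_eq; rewrite /GRing.scale/=; ring.
have is_derive_F (x : R) : 0 < x -> is_derive x 1 F ((pearson l t p).[x] * w x + B * expR (- x)).
  move=> x0; have d := is_deriveB (is_derive_XpW p x0) (dexp x).
  by apply: (@is_derive_eq _ _ _ _ _ _ _ _ d); rewrite opprK.
have cvg_expRN (x : R) : expR (- y) @[y --> x] --> expR (- x).
  have cx : {for x, continuous (fun y : R => expR (- y))}.
    by apply: differentiable_continuous; apply/derivable1_diffP; exact: ex_derive.
  exact: cx.
rewrite (@Rintegral_ge0_continuous_FTC2y _ _ F 0 0)//.
- by rewrite /F weight0 mulr0 oppr0 expR0 mulr1 !sub0r opprK.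
- apply/continuous_within_itvcyP; split.
    move=> x; rewrite in_itv/= andbT => x0; apply: cvgD.
      exact: continuous_poly_weight.
    by apply: cvgM; [exact: cvg_cst|exact: cvg_expRN].
  apply: cvgD; first exact: poly_weight_cvg0.
  by apply: cvgM; [exact: cvg_cst|apply: cvg_at_right_filter; exact: cvg_expRN].
- have [C C0 pC] := poly_weight_le ('X * p).
  have e0 : expR (- x) @[x --> +oo] --> (0 : R) by exact: cvgr_expR.
  have Fb : forall x, 0 < x -> `|F x| <= (C + `|B|) * expR (- x).
    move=> x x0; rewrite /F (le_trans (ler_normB _ _))// mulrDl lerD ?pC//.
    by rewrite normrM [`|expR _|]ger0_norm ?expR_ge0.
  apply: norm_cvg0.
  apply: (@squeeze_cvgr _ _ _ _ (fun=> 0) (fun x => (C + `|B|) * expR (- x))).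
  + near=> x; rewrite normr_ge0/= Fb//.
  + exact: cvg_cst.
  + by rewrite -[X in _ --> X](mulr0 (C + `|B|)); apply: cvgM; [exact: cvg_cst|].
- by move=> x x0; have [] := is_derive_F x x0.
- apply: cvgB; first exact: poly_weight_cvg0.
  by apply: cvgM; [exact: cvg_cst|apply: cvg_at_right_filter; exact: cvg_expRN].
- move=> x; rewrite in_itv/= andbT => x0.
  by rewrite derive1E; have [_ ->] := is_derive_F x x0.
Unshelve. all: by end_near. Qed.

(** Integration by parts: the boundary terms of x p(x) w(x) vanish at 0 and at
    infinity. *)
Lemma moment_pearson p : moment (pearson l t p) = 0.
Proof.
have [B B0 pB] := poly_weight_le (pearson l t p).
have pos q : pearson l t q = pearson l t p \/ pearson l t q = 0 ->
    forall x, 0 <= x -> 0 <= (pearson l t q).[x] * w x + B * expR (- x).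
  case=> -> x; rewrite le_eqVlt => /predU1P[<-|x0].
  - by rewrite weight0 mulr0 add0r mulr_ge0 ?expR_ge0.
  - by have := pB x x0; rewrite ler_norml => /andP[h _]; rewrite -lerBlDr sub0r.
  - by rewrite weight0 mulr0 add0r mulr_ge0 ?expR_ge0.
  - by rewrite horner0 mul0r add0r mulr_ge0 ?expR_ge0.
have p0 : pearson l t 0 = 0 by rewrite /pearson deriv0 !mulr0 !scaler0 !addr0 subr0.
have I1 := integral_pearson_shift (pos p (or_introl erefl)).
(* For the zero polynomial only the integral of the shift is left. *)
have I0 := integral_pearson_shift (pos 0 (or_intror p0)).
have intB : mu.-integrable D (EFin \o (fun x => B * expR (- x))).
  rewrite (_ : EFin \o _ = fun x => B%:E * (expR (- x))%:E)%E//.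
  by apply: integrableZl => //; exact: integrable_expRN.
have intD q : mu.-integrable D (EFin \o (fun x => q.[x] * w x + B * expR (- x))).
  rewrite (_ : EFin \o _ = (EFin \o g q) \+ (EFin \o (fun x => (B * expR (- x))%R)))%E//.
  by apply: integrableD => //; exact: integrable_poly_weight.
rewrite -Rintegral_itv_obnd_cbnd// in I1.
rewrite -Rintegral_itv_obnd_cbnd// in I0.
rewrite RintegralD// in I1; last exact: integrable_poly_weight.
rewrite RintegralD// in I0; last exact: integrable_poly_weight.
have z : \int[mu]_(x in D) ((pearson l t 0).[x] * w x) = 0.
  by rewrite /Rintegral integral0_eq// => x _; rewrite p0 horner0 mul0r.
rewrite z add0r in I0; rewrite I0 in I1.
by apply: (addIr B); rewrite add0r.
Qed.

End Moments.

(** * The symmetrized recurrence coefficients and Freud's equations *)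

Section FreudEquations.
Variables (R : realFieldType) (l t : R) (L : {scalar {poly R}}).
Hypothesis L_pearson : forall p : {poly R}, L (pearson l t p) = 0.
Hypothesis L_gt0 : forall p : {poly R},
  p != 0 -> (forall x, 0 < x -> 0 <= p.[x]) -> 0 < L p.
Variables (P : nat -> {poly R}) (h : nat -> R).
Hypothesis P_monic : forall n, P n \is monic.
Hypothesis size_P : forall n, size (P n) = n.+1.
Hypothesis P_orth : forall m n, L (P m * P n) = if m == n then h n else 0.

Let LD p q : L (p + q) = L p + L q.
Proof. exact: linearD. Qed.
Let LB p q : L (p - q) = L p - L q.
Proof. exact: linearB. Qed.
Let LZ k p : L (k *: p) = k * L p.
Proof. exact: linearZ. Qed.

Lemma size_deriv_leq n (p : {poly R}) : (size p <= n.+1)%N -> (size p^`() <= n)%N.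
Proof.
by move=> sp; apply/leq_sizeP => j nj; rewrite coef_deriv nth_default ?mul0rn// (leq_trans sp).
Qed.

Lemma size_X_deriv_leq n (p : {poly R}) :
  (size p <= n.+1)%N -> (size ('X * p^`())%R <= n.+1)%N.
Proof.
move=> sp; rewrite (leq_trans (size_polyMleq _ _))// size_polyX ltnS.
exact: size_deriv_leq.
Qed.

Lemma P_lead n : (P n)`_n = 1.
Proof. by have /monicP := P_monic n; rewrite /lead_coef size_P. Qed.

Lemma size_XP n : (size ('X * P n)%R <= n.+2)%N.
Proof. by rewrite (leq_trans (size_polyMleq _ _))// size_polyX size_P. Qed.

Lemma P_above n i : (n < i)%N -> (P n)`_i = 0.
Proof. by move=> ni; rewrite nth_default// size_P. Qed.

Lemma h_gt0 n : 0 < h n.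
Proof.
have := P_orth n n; rewrite eqxx => <-; apply: L_gt0 => [|x _].
  by rewrite mulf_neq0// monic_neq0.
by rewrite hornerM -expr2 sqr_ge0.
Qed.

Lemma orth_low m n (r : {poly R}) : (size r <= m)%N -> (m <= n)%N -> L (P n * r) = 0.
Proof.
elim: m r => [|m IH] r; first by rewrite leqn0 size_poly_eq0 => /eqP-> _; rewrite mulr0 linear0.
move=> sr mn; have -> : P n * r = r`_m *: (P m * P n) + P n * (r - r`_m *: P m).
  by rewrite mulrBr -scalerAr [P n * P m]mulrC addrC subrK.
rewrite LD LZ P_orth ltn_eqF// mulr0 add0r IH ?(ltnW mn)//.
apply/leq_sizeP => j; rewrite leq_eqVlt => /predU1P[<-|mj].
  by rewrite coefB coefZ P_lead mulr1 subrr.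
by rewrite coefB coefZ P_above// mulr0 subr0 nth_default// (leq_trans sr).
Qed.

(** Subtracting the multiple of P_n that has the same leading coefficient leaves a
    polynomial of lower degree.  All the moments below are evaluated by reading
    off a coefficient in this way. *)
Lemma orth_lead n (r : {poly R}) : (size r <= n.+1)%N -> L (P n * r) = r`_n * h n.
Proof.
move=> sr; have -> : P n * r = r`_n *: (P n * P n) + P n * (r - r`_n *: P n).
  by rewrite mulrBr -scalerAr addrC subrK.
rewrite LD LZ P_orth eqxx (@orth_low n)// ?addr0//.
apply/leq_sizeP => j; rewrite leq_eqVlt => /predU1P[<-|mj].
  by rewrite coefB coefZ P_lead mulr1 subrr.
by rewrite coefB coefZ P_above// mulr0 subr0 nth_default// (leq_trans sr).
Qed.

(** If 0 were a root, then P_n = x r with r of degree n - 1, and the positive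
    number L (x r^2) would be L (P_n r) = 0. *)
Lemma P_at0 n : (P n)`_0 != 0.
Proof.
case: n => [|n]; first by rewrite P_lead oner_eq0.
apply/eqP => P0; pose r := drop_poly 1 (P n.+1).
have Pr : P n.+1 = 'X * r.
  by apply/polyP => -[|i]; rewrite coefXM// coef_drop_poly addn1.
have sr : (size r <= n.+1)%N by rewrite size_drop_poly size_P subn1.
suff : 0 < L (P n.+1 * r) by rewrite (@orth_low n.+1)// ltxx.
apply: L_gt0.
  rewrite mulf_neq0 ?(monic_neq0 (P_monic _))//; apply/eqP => r0; move/eqP: (P_lead n.+1).
  by rewrite Pr r0 mulr0 coef0 eq_sym oner_eq0.
by move=> x x0; rewrite Pr !hornerM hornerX -mulrA -expr2 mulr_ge0 ?sqr_ge0// ltW.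
Qed.

(** The coefficient gamma_(2n-1) of the symmetrized weight, for n > 0. *)
Definition gamma_odd n := - (P n)`_0 / (P n.-1)`_0.
Local Notation c := gamma_odd.

(** The kernel polynomials: they are orthogonal for x times the weight, and
    y Q_n(y^2) is the orthogonal polynomial of degree 2n + 1 of the symmetrized
    weight. *)
Definition kernel n := drop_poly 1 (P n.+1 + c n.+1 *: P n).
Local Notation Q := kernel.

Lemma XQ n : 'X * Q n = P n.+1 + c n.+1 *: P n.
Proof.
apply/polyP => -[|i]; rewrite coefXM/=.
  by rewrite coefD coefZ /c/= mulrVK ?subrr// ?unitfE ?P_at0// mulNr subrr.
by rewrite coef_drop_poly addn1.
Qed.

Lemma Q_coef n i : (Q n)`_i = (P n.+1)`_i.+1 + c n.+1 * (P n)`_i.+1.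
Proof. by rewrite coef_drop_poly addn1 coefD coefZ. Qed.

Lemma Q_lead n : (Q n)`_n = 1.
Proof. by rewrite Q_coef P_lead P_above// mulr0 addr0. Qed.

Lemma size_Q n : (size (Q n) <= n.+1)%N.
Proof.
by apply/leq_sizeP => j nj; rewrite Q_coef !P_above ?mulr0 ?addr0// ltnW.
Qed.

(** By the recurrence ['X * Q n = P n.+1 + c n.+1 *: P n], pairing with ['X * Q n]
    reduces to orthogonality of the P's. *)
Lemma orth_Q n (r : {poly R}) : (size r <= n.+1)%N ->
  L ('X * Q n * r) = c n.+1 * h n * r`_n.
Proof.
move=> sr; rewrite XQ mulrDl LD orth_lead ?(leq_trans sr)//.
by rewrite (nth_default _ sr) mul0r add0r -scalerAl LZ orth_lead// -mulrA [h n * _]mulrC.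
Qed.

Lemma gamma_odd_gt0 n : 0 < c n.+1.
Proof.
rewrite -(pmulr_lgt0 _ (h_gt0 n)) -[_ * _]mulr1 -(Q_lead n) -orth_Q ?size_Q//.
apply: L_gt0 => [|x x0]; last first.
  by rewrite !hornerM hornerX -mulrA -expr2 mulr_ge0 ?sqr_ge0// ltW.
have Q0 : Q n != 0 by apply/eqP => Q0; have /eqP := Q_lead n; rewrite Q0 coef0 eq_sym oner_eq0.
by rewrite !mulf_neq0// polyX_eq0.
Qed.

(** The coefficient gamma_(2n) of the symmetrized weight, for n > 0: the ratio of
    the squared norms of S_(2n) and S_(2n-1). *)
Definition gamma_even n := h n / (c n * h n.-1).
Local Notation a := gamma_even.

Lemma gamma_even_gt0 n : 0 < a n.+1.
Proof. by rewrite /a divr_gt0 ?h_gt0// mulr_gt0 ?h_gt0 ?gamma_odd_gt0. Qed.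

Lemma norm_succ n : h n.+1 = a n.+1 * (c n.+1 * h n).
Proof. by rewrite /a mulfVK// gt_eqF// mulr_gt0 ?h_gt0 ?gamma_odd_gt0. Qed.

(** In the recurrence S_(2n+3) = y S_(2n+2) - gamma_(2n+2) S_(2n+1) the difference
    P_(n+1) - Q_(n+1) is a multiple of Q_n; pairing with ['X * Q n] identifies the
    factor. *)
Lemma coef_P_sub_Q n : (P n.+1)`_n - (Q n.+1)`_n = a n.+1.
Proof.
have ch0 : c n.+1 * h n != 0 by rewrite gt_eqF// mulr_gt0 ?h_gt0 ?gamma_odd_gt0.
apply: (mulfI ch0); rewrite [RHS]mulrC -norm_succ.
have sPQ : (size (P n.+1 - Q n.+1)%R <= n.+1)%N.
  apply/leq_sizeP => j; rewrite leq_eqVlt => /predU1P[<-|nj].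
    by rewrite coefB P_lead Q_lead subrr.
  by rewrite coefB P_above// nth_default ?subrr// (leq_trans (size_Q _)).
rewrite -coefB -orth_Q// mulrBr LB.
rewrite [X in _ - X](_ : _ = 0) ?subr0; last first.
  have -> : 'X * Q n * Q n.+1 = 'X * Q n.+1 * Q n by ring.
  by rewrite orth_Q ?(leq_trans (size_Q _))// nth_default ?size_Q// mulr0.
rewrite XQ mulrDl -scalerAl LD LZ !P_orth eqxx.
by rewrite (ltn_eqF (ltnSn n)) mulr0 addr0.
Qed.

(** The diagonal recurrence coefficient of the P's is the sum of two consecutive
    gammas, since y^2 S_m = y (S_(m+1) + gamma_m S_(m-1)). *)
Lemma L_XPP n : L ('X * P n.+1 * P n.+1) = (a n.+1 + c n.+2) * h n.+1.
Proof.
have -> : 'X * P n.+1 * P n.+1 = 'X * Q n.+1 * P n.+1 + P n.+1 * ('X * (P n.+1 - Q n.+1)) by ring.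
rewrite LD orth_Q ?size_P// P_lead mulr1 orth_lead.
  by rewrite coefXM/= coefB coef_P_sub_Q; ring.
apply/leq_sizeP => -[//|j]; rewrite ltnS coefXM/= => nj.
rewrite coefB; have [<-|nej] := eqVneq n.+1 j; first by rewrite P_lead Q_lead subrr.
have lj : (n.+1 < j)%N by rewrite ltn_neqAle nej.
by rewrite P_above// nth_default ?subrr// (leq_trans (size_Q _)).
Qed.

Lemma coef_Pstep n : (P n.+1)`_n - (P n.+2)`_n.+1 = a n.+1 + c n.+2.
Proof.
rewrite -coef_P_sub_Q Q_coef P_lead; ring.
Qed.

(** The Pearson relation for P_(n+1) Q_n, that is for S_(2n+2) S_(2n+1). *)
Lemma freud_even n :
  2 * a n.+1 * (c n.+2 + a n.+1 + c n.+1 - t / 2) = n.+1%:R.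
Proof.
have := L_pearson (P n.+1 * Q n).
rewrite /pearson derivM.
have -> : 'X * ((P n.+1)^`() * Q n + P n.+1 * (Q n)^`())
  + (l + 1) *: (P n.+1 * Q n) + t *: ('X * (P n.+1 * Q n))
  - 2 *: ('X^2 * (P n.+1 * Q n)) =
  'X * Q n * (P n.+1)^`() + P n.+1 * ('X * (Q n)^`()) + (l + 1) *: (P n.+1 * Q n)
  + t *: (P n.+1 * ('X * Q n)) - 2 *: ('X * P n.+1 * ('X * Q n)).
  by rewrite -!mul_polyC; ring.
rewrite LB !LD !LZ.
rewrite orth_Q; last by rewrite size_deriv_leq// size_P.
rewrite XQ.
rewrite coef_deriv P_lead.
rewrite (@orth_low n.+1)//; last first.
  by rewrite size_X_deriv_leq// size_Q.
rewrite (@orth_low n.+1)// ?size_Q//.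
rewrite mulrDr LD -scalerAr LZ !P_orth eqxx eq_sym (ltn_eqF (ltnSn n)).
rewrite ['X * _ * (_ + _)]mulrDr LD -scalerAr LZ L_XPP.
have -> : 'X * P n.+1 * P n = P n.+1 * ('X * P n) by ring.
rewrite orth_lead ?size_XP//.
rewrite coefXM/= P_lead norm_succ => E.
have chn0 : c n.+1 * h n != 0 by rewrite gt_eqF// mulr_gt0 ?h_gt0 ?gamma_odd_gt0.
by apply: (mulfI chn0); rewrite -[RHS]subr0 -E; field.
Qed.

(** The Pearson relation for P_(n+1) Q_(n+1), that is for S_(2n+2) S_(2n+3); the
    summand l survives because [P n.+1 * Q n.+1] has a nonzero moment. *)
Lemma freud_odd n :
  2 * c n.+2 * (a n.+2 + c n.+2 + a n.+1 - t / 2) = n.+2%:R + l.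
Proof.
have := L_pearson (P n.+1 * Q n.+1).
rewrite /pearson derivM.
have -> : 'X * ((P n.+1)^`() * Q n.+1 + P n.+1 * (Q n.+1)^`())
  + (l + 1) *: (P n.+1 * Q n.+1) + t *: ('X * (P n.+1 * Q n.+1))
  - 2 *: ('X^2 * (P n.+1 * Q n.+1)) =
  'X * Q n.+1 * (P n.+1)^`() + P n.+1 * ('X * (Q n.+1)^`())
  + (l + 1) *: (P n.+1 * Q n.+1) + t *: ('X * Q n.+1 * P n.+1)
  - 2 *: ('X * Q n.+1 * ('X * P n.+1)).
  by rewrite -!mul_polyC; ring.
have sP' : (size (P n.+1)^`()%R <= n.+1)%N.
  by rewrite size_deriv_leq// size_P.
rewrite LB !LD !LZ [L ('X * _ * (P _)^`())]orth_Q 1?leqW//.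
rewrite [_`_n.+1]nth_default// mulr0 add0r orth_Q ?size_P// P_lead mulr1.
rewrite [L (_ * Q _)]orth_lead ?size_Q// Q_lead mul1r.
rewrite orth_lead ?size_X_deriv_leq ?size_Q//.
rewrite coefXM/= coef_deriv Q_lead.
rewrite XQ [(_ + _ *: _) * _]mulrDl -[c n.+2 *: _ * _]scalerAl LD LZ.
have -> : P n.+1 * ('X * P n.+1) = 'X * P n.+1 * P n.+1 by ring.
rewrite L_XPP orth_lead ?size_XP//.
rewrite coefXM/= P_lead mul1r [h n.+2]norm_succ => E.
have hn0 : h n.+1 != 0 by rewrite gt_eqF// h_gt0.
by apply: (mulfI hn0); rewrite -[RHS]subr0 -E; field.
Qed.

(** In the Pearson relation for P_(n+2) P_(n+1), the polynomial
    x P_(n+2)' - (n + 2) P_(n+2) has degree n + 1 and leading coefficient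
    - p(n + 2, t).  Freud's equations then eliminate the two outer gammas. *)
Lemma subleading_gamma n :
  (P n.+2)`_n.+1 = - n.+2%:R * c n.+2 - (n.+2%:R + l) * a n.+2
    + 2 * a n.+2 * c n.+2 * (a n.+2 + c n.+2 - t / 2).
Proof.
suff -> : (P n.+2)`_n.+1 =
    - (a n.+2 * c n.+2) * (2 * (a n.+2 + c n.+3 + (a n.+1 + c n.+2)) - t).
  by rewrite -freud_odd -(freud_even n.+1); field.
have := L_pearson (P n.+2 * P n.+1).
rewrite /pearson derivM.
pose r := 'X * (P n.+2)^`() - n.+2%:R *: P n.+2.
pose u := 'X * P n.+1 - P n.+2.
have -> : 'X * ((P n.+2)^`() * P n.+1 + P n.+2 * (P n.+1)^`())
  + (l + 1) *: (P n.+2 * P n.+1) + t *: ('X * (P n.+2 * P n.+1))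
  - 2 *: ('X^2 * (P n.+2 * P n.+1)) =
  P n.+1 * r + n.+2%:R *: (P n.+2 * P n.+1) + P n.+2 * ('X * (P n.+1)^`())
  + (l + 1) *: (P n.+2 * P n.+1) + t *: (P n.+2 * ('X * P n.+1))
  - 2 *: ('X * P n.+2 * P n.+2 + P n.+2 * ('X * u)).
  by rewrite /r /u -!mul_polyC; ring.
have sr : (size r <= n.+2)%N.
  apply/leq_sizeP => -[//|j]; rewrite ltnS => nj; rewrite coefB coefZ coefXM/= coef_deriv.
  move: nj; rewrite leq_eqVlt => /predU1P[<-|nj]; first by rewrite P_lead mulr1 subrr.
  by rewrite P_above// mul0rn mulr0 subrr.
have su : (size u <= n.+2)%N.
  apply/leq_sizeP => -[//|j]; rewrite ltnS => nj; rewrite coefB coefXM/=.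
  move: nj; rewrite leq_eqVlt => /predU1P[<-|nj]; first by rewrite !P_lead subrr.
  by rewrite !P_above ?subrr// ltnW.
rewrite LB !LD !LZ LD P_orth.
rewrite (gtn_eqF (ltnSn n.+1)) !mulr0 addr0 L_XPP.
rewrite [L (P n.+1 * r)]orth_lead// coefB coefZ coefXM/= coef_deriv.
rewrite [L (P n.+2 * ('X * (P n.+1)^`()))](@orth_low n.+2)// ?size_X_deriv_leq ?size_P//.
rewrite orth_lead ?size_XP//.
rewrite coefXM/= P_lead.
rewrite orth_lead; last first.
  by rewrite (leq_trans (size_polyMleq _ _))// size_polyX/= ltnS.
rewrite coefXM/= coefB coefXM/= coef_Pstep [h n.+2]norm_succ => E.
have hn0 : h n.+1 != 0 by rewrite gt_eqF// h_gt0.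
by apply: (mulfI hn0); rewrite -[LHS]addr0 -[X in _ + X]E -mulr_natr; ring.
Qed.

End FreudEquations.

(** * A discrete maximum principle *)

Lemma ge1Dhalf_expr (R : realFieldType) n : 1 + n%:R / 2 <= (3 / 2 : R) ^+ n.
Proof.
elim: n => [|n IH]; first by rewrite expr0; lra.
rewrite exprS -[n.+1]addn1 natrD; have := ler0n R n; nra.
Qed.

(** A positive value of e forces the next value to be 3/2 times larger: by
    induction from [e N <= 0] the previous value cannot be the larger neighbour.
    The resulting geometric growth contradicts the linear bound. *)
Lemma max_principle (R : archiRealFieldType) (e : nat -> R) (N : nat) (C : R) :
  (forall n, (N < n)%N -> e n <= 2 / 3 * Num.max (e n.-1) (e n.+1)) ->
  (forall n, (N <= n)%N -> e n <= C * n%:R) ->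
  e N <= 0 -> forall n, (N <= n)%N -> e n <= 0.
Proof.
move=> e_sub e_lin eN m Nm; rewrite leNgt; apply/negP => em.
have grow n : (N <= n)%N -> 0 < e n -> 3 / 2 * e n <= e n.+1.
  elim: n => [|n IH].
    by rewrite leqn0 => /eqP N0; rewrite -N0 ltNge eN.
  rewrite leq_eqVlt => /predU1P[<-|]; first by rewrite ltNge eN.
  rewrite ltnS => Nn en; have /= := e_sub n.+1 Nn.
  case: (leP (e n) (e n.+2)) => [|_] le_e; first by lra.
  have := IH Nn; have : 0 < e n by lra.
  by move=> e0 /(_ e0); lra.
have em_geom j : (3 / 2) ^+ j * e m <= e (m + j)%N.
  elim: j => [|j IH]; first by rewrite expr0 mul1r addn0.
  have p0 : 0 < (3 / 2 : R) ^+ j by apply: exprn_gt0; lra.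
  rewrite addnS exprS -mulrA; apply: le_trans (grow (m + j)%N _ _); first by lra.
    by rewrite (leq_trans Nm)// leq_addr.
  by rewrite (lt_le_trans _ IH)// mulr_gt0.
have /= := archi_boundP (normr_ge0 (8 * (`|C| * (1 + m%:R)) / e m)).
set i := Num.bound _ => Hi.
have := em_geom (i + i)%N; have := e_lin (m + (i + i))%N.
rewrite (leq_trans Nm) ?leq_addr// => /(_ isT) h1 h2.
have := ge1Dhalf_expr R i; have i0 := ler0n R i; have m0 := ler0n R m => h3.
have {h1 h2} := le_trans h2 h1; rewrite exprD !natrD.
move: Hi; rewrite ger0_norm; last first.
  by rewrite divr_ge0 ?mulr_ge0 ?normr_ge0 ?addr_ge0// ltW.
rewrite ltr_pdivrMr// => Hi.
have hC := ler_norm C; have hC0 := normr_ge0 C.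
set K := `|C| in Hi hC hC0; set p := (3 / 2) ^+ i in h3 *.
move=> h4.
have h5 : p * p * e m <= K * (m%:R + (i%:R + i%:R)).
  by rewrite (le_trans h4)// ler_wpM2r// !addr_ge0.
have h6 : (1 + i%:R / 2) * (1 + i%:R / 2) * e m <= p * p * e m.
  by rewrite ler_wpM2r ?(ltW em)// ler_pM//; lra.
(* By Bernoulli the growth after 2i steps is at least (1 + i/2)^2, which is
   quadratic in i and beats K (m + 2i) for the chosen i. *)
have h7 : i%:R * (8 * (K * (1 + m%:R))) <= i%:R * (i%:R * e m) by rewrite ler_wpM2l// ltW.
have h8 : 0 <= K * m%:R by rewrite mulr_ge0.
have h9 : 0 <= K * m%:R * i%:R by rewrite mulr_ge0.
nra.
Qed.

(** For K >= 6 E the multiple K v is a supersolution: one step costs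
    2/3 * 5/4 = 5/6 of it, and the remaining sixth pays for E v.  The maximum
    principle applies to d - K v. *)
Lemma barrier_decay (R : archiRealFieldType) (d v : nat -> R) (N : nat) (C E : R) :
  (forall n, (N <= n)%N -> 0 < v n) ->
  (forall n, (N < n)%N -> v n.-1 <= 5 / 4 * v n /\ v n.+1 <= 5 / 4 * v n) ->
  (forall n, (N < n)%N -> d n <= 2 / 3 * Num.max (d n.-1) (d n.+1) + E * v n) ->
  (forall n, (N <= n)%N -> d n <= C * n%:R) ->
  exists K, forall n, (N <= n)%N -> d n <= K * v n.
Proof.
move=> v0 vstep dstep d_lin.
pose K := Num.max 0 (Num.max (6 * E) (d N / v N)).
have K0 : 0 <= K by rewrite le_max lexx.
have KE : 6 * E <= K by rewrite !le_max lexx !orbT.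
have KN : d N <= K * v N by rewrite -ler_pdivrMr ?v0// !le_max lexx !orbT.
exists K => n Nn; rewrite -subr_le0; move: n Nn.
apply: (@max_principle _ (fun n => d n - K * v n) N C) => [n Nn|n Nn|]; last by rewrite subr_le0.
  have [v1 v2] := vstep n Nn; have vn := v0 n (ltnW Nn); have Ed := dstep n Nn.
  have Kv1 : K * v n.-1 <= K * (5 / 4 * v n) by rewrite ler_wpM2l.
  have Kv2 : K * v n.+1 <= K * (5 / 4 * v n) by rewrite ler_wpM2l.
  have Ev : 6 * E * v n <= K * v n by rewrite ler_wpM2r// ltW.
  move: Ed; case: (leP (d n.-1) (d n.+1)) => _ Ed; [set M := Num.max _ _ |set M := Num.max _ _].
    have : d n.+1 - K * v n.+1 <= M by rewrite le_max lexx orbT.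
    by lra.
  have : d n.-1 - K * v n.-1 <= M by rewrite le_max lexx.
  by lra.
by rewrite (le_trans _ (d_lin n Nn))// gerBl mulr_ge0// ltW// v0.
Qed.

(** * Expansions in powers of the inverse square root of the index *)

Section Expansions.
Variable R : realType.
Implicit Types (f g : nat -> R) (p q : {poly R}) (K : nat).

Definition rsqrt (n : nat) : R := (Num.sqrt n%:R)^-1.
Local Notation s := rsqrt.

Lemma rsqrt_gt0 n : (0 < n)%N -> 0 < s n.
Proof. by move=> n0; rewrite invr_gt0 sqrtr_gt0 ltr0n. Qed.

Lemma rsqrt_ge0 n : 0 <= s n.
Proof. by rewrite invr_ge0 sqrtr_ge0. Qed.

Lemma sqr_rsqrt n : s n ^+ 2 = n%:R^-1.
Proof. by rewrite exprVn sqr_sqrtr. Qed.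

Lemma rsqrt_le1 n : s n <= 1.
Proof.
rewrite -(@expr_le1 _ 2)// ?rsqrt_ge0// sqr_rsqrt.
by case: n => [|n]; rewrite ?invr0// invf_le1 ?ltr0n// ler1n.
Qed.

Lemma rsqrt_small e : 0 < e -> \forall n \near \oo, s n <= e.
Proof.
move=> e0; near=> n.
have n0 : (0 < n)%N by near: n; exact: nbhs_infty_gt.
rewrite -(@ler_pXn2r _ 2)// ?nnegrE ?rsqrt_ge0 ?(ltW e0)//.
rewrite sqr_rsqrt -[leRHS]invrK lef_pV2 ?posrE ?invr_gt0 ?exprn_gt0 ?ltr0n//.
by near: n; exact: nbhs_infty_ger.
Unshelve. all: by end_near. Qed.

(** Truncated expansions are kept as polynomials, so that the coefficients of a
    compound expression come out of polynomial arithmetic. *)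
Definition expands K f p :=
  exists C, \forall n \near \oo, `|f n - p.[s n]| <= C * s n ^+ K.

Lemma horner_bounded p : exists B, forall n, `|p.[s n]| <= B.
Proof.
exists (\sum_(i < size p) `|p`_i|) => n; rewrite horner_coef.
apply: le_trans (ler_norm_sum _ _ _) _; apply: ler_sum => i _.
by rewrite normrM ler_piMr// ger0_norm ?exprn_ge0 ?exprn_ile1 ?rsqrt_ge0 ?rsqrt_le1.
Qed.

Lemma expandsP K f p : expands K f p ->
  exists2 C, 0 <= C & \forall n \near \oo, `|f n - p.[s n]| <= C * s n ^+ K.
Proof.
move=> [C fC]; exists `|C| => //; apply: filterS fC => n /le_trans; apply.
by rewrite ler_wpM2r ?exprn_ge0 ?rsqrt_ge0// ler_norm.
Qed.

Lemma eq_expands K f g p : (\forall n \near \oo, f n = g n) ->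
  expands K f p -> expands K g p.
Proof.
by move=> fg [C fC]; exists C; apply: filterS2 fg fC => n ->.
Qed.

Lemma expands_horner K p : expands K (fun n => p.[s n]) p.
Proof. by exists 0; apply: nearW => n; rewrite subrr normr0 mul0r. Qed.

(** Terms of degree at least K are absorbed by the error. *)
Lemma expands_mod K f p q : expands K f p ->
  (forall i, (i < K)%N -> p`_i = q`_i) -> expands K f q.
Proof.
move=> [C fC] pq.
have pqE : p = q + drop_poly K (p - q) * 'X^K.
  apply/polyP => i; rewrite coefD coefMXn coef_drop_poly.
  case: ltnP => [/pq->|Ki]; first by rewrite addr0.
  by rewrite subnK// coefB addrC subrK.
have [B rB] := horner_bounded (drop_poly K (p - q)).
exists (C + B); apply: filterS fC => n fn.
have -> : f n - q.[s n] = f n - p.[s n] + (drop_poly K (p - q)).[s n] * s n ^+ K.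
  by rewrite {1}pqE hornerD hornerM hornerXn; ring.
rewrite (le_trans (ler_normD _ _))// mulrDl lerD// normrM.
by rewrite [`|s n ^+ K|]ger0_norm ?ler_wpM2r ?exprn_ge0 ?rsqrt_ge0.
Qed.

Lemma expands_weaken K J f p : (J <= K)%N -> expands K f p -> expands J f p.
Proof.
move=> JK /expandsP[C C0 fC]; exists C; apply: filterS fC => n /le_trans; apply.
by rewrite ler_wpM2l// ler_wiXn2l ?rsqrt_ge0 ?rsqrt_le1.
Qed.

Lemma expandsD K f g p q : expands K f p -> expands K g q ->
  expands K (fun n => f n + g n) (p + q).
Proof.
move=> [C fC] [D gD]; exists (C + D); apply: filterS2 fC gD => n fn gn.
by rewrite hornerD opprD addrACA (le_trans (ler_normD _ _))// mulrDl lerD.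
Qed.

Lemma expandsN K f p : expands K f p -> expands K (fun n => - f n) (- p).
Proof.
by move=> [C fC]; exists C; apply: filterS fC => n; rewrite hornerN -opprD normrN.
Qed.

Lemma expandsB K f g p q : expands K f p -> expands K g q ->
  expands K (fun n => f n - g n) (p - q).
Proof. by move=> fp /expandsN; exact: expandsD. Qed.

Lemma expands_bounded K f p : expands K f p ->
  exists2 B, 0 <= B & \forall n \near \oo, `|f n| <= B.
Proof.
move=> /expandsP[C C0 fC]; have [B pB] := horner_bounded p.
exists (C + B); first by rewrite addr_ge0// (le_trans _ (pB 0%N)).
apply: filterS fC => n fn; rewrite -[f n](subrK p.[s n]).
rewrite (le_trans (ler_normD _ _))// lerD// (le_trans fn)// ler_piMr//.
by rewrite exprn_ile1 ?rsqrt_ge0 ?rsqrt_le1.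
Qed.

Lemma expandsM K f g p q : expands K f p -> expands K g q ->
  expands K (fun n => f n * g n) (p * q).
Proof.
move=> fp; have [B B0 fB] := expands_bounded fp; case: fp => [C fC].
have [D qD] := horner_bounded q.
move=> [E gE]; exists (B * E + C * D); near=> n.
have -> : f n * g n - (p * q).[s n]
    = f n * (g n - q.[s n]) + (f n - p.[s n]) * q.[s n] by rewrite hornerM; ring.
rewrite (le_trans (ler_normD _ _))// !normrM mulrDl -[B * E * _]mulrA lerD//.
  by apply: ler_pM => //; near: n; [exact: fB|exact: gE].
by rewrite mulrAC; apply: ler_pM => //; near: n; exact: fC.
Unshelve. all: by end_near. Qed.

Lemma expandsZ K f p k : expands K f p -> expands K (fun n => k * f n) (k *: p).
Proof.
move=> fp; rewrite -mul_polyC; apply: eq_expands (expandsM (expands_horner K k%:P) fp).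
by apply: nearW => n; rewrite hornerC.
Qed.

(** An inverse modulo the K-th power gives the expansion of the inverse sequence,
    since 1/f - q = (1 - f q) / f. *)
Lemma expandsV K f p q c : 0 < c -> (\forall n \near \oo, c <= f n) ->
  expands K f p -> (forall i, (i < K)%N -> (p * q)`_i = (1 : {poly R})`_i) ->
  expands K (fun n => (f n)^-1) q.
Proof.
move=> c0 fc fp pq.
have [C C0 fqC] := expandsP (expands_mod (expandsM fp (expands_horner K q)) pq).
exists (c^-1 * C); near=> n.
have cf : c <= f n by near: n.
have f0 : 0 < f n by exact: lt_le_trans cf.
have -> : (f n)^-1 - q.[s n] = - (f n)^-1 * (f n * q.[s n] - (1 : {poly R}).[s n]).
  by rewrite hornerC; field; rewrite gt_eqF.
rewrite normrM normrN -mulrA ler_pM//; last by near: n.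
by rewrite ger0_norm ?invr_ge0 ?(ltW f0)// lef_pV2.
Unshelve. all: by end_near. Qed.

(** With v = e u^2, the square of 1 + v/2 - v^2/8 is 1 + v up to a multiple of v^3,
    and a difference of square roots is the difference of the squares over the
    sum. *)
Lemma sqrt1p_expansion (e u : R) : `|e| <= 1 -> 0 <= u <= 1 ->
  `|Num.sqrt (1 + e * u ^+ 2) - (1 + e / 2 * u ^+ 2 - e ^+ 2 / 8 * u ^+ 4)| <= u ^+ 6.
Proof.
rewrite ler_norml => /andP[e1 e2] /andP[u0 u1].
have u2 : 0 <= u ^+ 2 <= 1 by rewrite sqr_ge0 exprn_ile1.
set v := e * u ^+ 2.
have v1 : -1 <= v <= 1 by rewrite /v; nra.
set q := 1 + v / 2 - v ^+ 2 / 8.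
have -> : 1 + e / 2 * u ^+ 2 - e ^+ 2 / 8 * u ^+ 4 = q by rewrite /q /v; field.
have q0 : 3 / 8 <= q by rewrite /q; nra.
have r0 := sqrtr_ge0 (1 + v).
have rr : Num.sqrt (1 + v) ^+ 2 = 1 + v by rewrite sqr_sqrtr//; lra.
set r := Num.sqrt (1 + v) in r0 rr *.
have rq : (r - q) * (r + q) = v ^+ 3 * (8 - v) / 64 by rewrite -subr_sqr rr /q; field.
have v3 : `|v ^+ 3 * (8 - v) / 64| <= 3 / 8 * u ^+ 6.
  rewrite 2!normrM normrX /v normrM.
  rewrite [`|u ^+ 2|]ger0_norm ?sqr_ge0// exprMn -exprM.
  rewrite [`|8 - _|]ger0_norm; last by rewrite -/v; lra.
  rewrite -/v [`|64^-1|]ger0_norm ?invr_ge0//.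
  have e3 : `|e| ^+ 3 <= 1 by rewrite exprn_ile1// ler_norml e1.
  have u6 : 0 <= u ^+ 6 by rewrite exprn_ge0.
  have h : `|e| ^+ 3 * u ^+ 6 <= u ^+ 6 by rewrite ler_piMl.
  have h0 : 0 <= `|e| ^+ 3 * u ^+ 6 by rewrite mulr_ge0// exprn_ge0.
  rewrite (_ : 2 * 3 = 6)%N//; nra.
move: v3; rewrite -rq normrM [`|r + q|]ger0_norm; last by lra.
have := normr_ge0 (r - q); nra.
Qed.

End Expansions.

Definition coef_rules := (coefD, coefB, coefN, coefZ, coef1, coefC, coefX, coef_cons,
  coefXnM, coefXM, coef_Poly, coef_poly).

Ltac compute_coef :=
  rewrite ?coef_rules /=; do ?[rewrite coefM !big_ord_recr big_ord0 /=];
  rewrite ?coef_rules /= ?(subSS, subn0, sub0n) /= ?coef_rules /=.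

Section Shift.
Variables (R : realType) (e : R) (sh : nat -> nat).
Local Notation s := (@rsqrt R).
Hypothesis e_le1 : `|e| <= 1.
Hypothesis shE : \forall n \near \oo, (sh n)%:R = n%:R + e.

Lemma expands_shift_ratio : expands 6 (fun n => s n / s (sh n))
  (Poly [:: 1; 0; e / 2; 0; - (e ^+ 2 / 8)]).
Proof.
exists 1; near=> n.
have n0 : (0 < n)%N by near: n; exact: nbhs_infty_gt.
have -> : s n / s (sh n) = Num.sqrt (1 + e * s n ^+ 2).
  rewrite /rsqrt invrK mulrC -sqrtrV ?ler0n// -sqrtrM ?ler0n//.
  congr Num.sqrt; rewrite sqr_sqrtr ?invr_ge0// (_ : (sh n)%:R = n%:R + e); last by near: n.
  by rewrite mulrDl mulfV// pnatr_eq0 -lt0n.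
rewrite mul1r (_ : (Poly _).[_] = 1 + e / 2 * s n ^+ 2 - e ^+ 2 / 8 * s n ^+ 4).
  by rewrite sqrt1p_expansion// rsqrt_ge0 rsqrt_le1.
rewrite horner_Poly /=; ring.
Unshelve. all: by end_near. Qed.

Lemma expands_shift_ratioV : expands 6 (fun n => s (sh n) / s n)
  (Poly [:: 1; 0; - (e / 2); 0; 3 / 8 * e ^+ 2]).
Proof.
have := expands_shift_ratio => q.
apply: (@eq_expands _ _ (fun n => (s n / s (sh n))^-1)).
  by apply: nearW => n; rewrite invf_div.
apply: (@expandsV _ _ _ _ _ (1 / 2) _ _ q) => //; last first.
  by do 6?[case=> [_|]//; first by compute_coef; field].
have [C C0 qC] := expandsP (@expands_mod _ 2 _ _ 1 (expands_weaken (isT : (2 <= 6)%N) q)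
   ltac:(by do 2?[case=> [_|]//; first by compute_coef])).
near=> n.
have : `|s n / s (sh n) - (1 : {poly R}).[s n]| <= C * s n ^+ 2 by near: n.
have : s n <= 1 / (2 * (1 + C)) by near: n; apply: rsqrt_small; rewrite divr_gt0//; lra.
rewrite ler_pdivlMr; last by lra.
rewrite hornerC ler_norml => h1 /andP[h2 _].
have s1 := rsqrt_le1 R n; have s0 := rsqrt_ge0 R n.
have : C * s n ^+ 2 <= C * s n by rewrite ler_wpM2l// expr2 ler_piMl.
nra.
Unshelve. all: by end_near. Qed.

(** Here p.[s n] / s n stands for the formal series sqrt n * p(n^(-1/2)).  Its
    shift, divided by sqrt n, multiplies the term of degree i by the power i - 1
    of the ratio (1 + e / n)^(-1/2). *)
Lemma expands_shift (p : {poly R}) : (size p <= 6)%N ->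
  expands 6 (fun n => s n * (p.[s (sh n)] / s (sh n)))
    (Poly [:: p`_0; p`_1; p`_2 + e / 2 * p`_0; p`_3;
              p`_4 - e / 2 * p`_2 - e ^+ 2 / 8 * p`_0; p`_5 - e * p`_3]).
Proof.
move=> sp; pose Rp := Poly [:: 1; 0; - (e / 2); 0; 3 / 8 * e ^+ 2].
have r1 : expands 6 (fun n => s (sh n) / s n) Rp := expands_shift_ratioV.
have r2 := expandsM r1 r1; have r3 := expandsM r1 r2; have r4 := expandsM r1 r3.
have sX m : expands 6 (fun n => s n ^+ m) 'X^m.
  by apply: eq_expands (expands_horner 6 'X^m); apply: nearW => n; rewrite hornerXn.
have E := expandsD (expandsD (expandsD (expandsD (expandsD (expandsZ p`_0 expands_shift_ratio)
   (expandsZ p`_1 (sX 1%N))) (expandsZ p`_2 (expandsM (sX 2%N) r1)))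
   (expandsZ p`_3 (expandsM (sX 3%N) r2))) (expandsZ p`_4 (expandsM (sX 4%N) r3)))
   (expandsZ p`_5 (expandsM (sX 5%N) r4)).
apply: eq_expands (expands_mod E _).
  near=> n.
  have s0 : s n != 0.
    by rewrite gt_eqF// rsqrt_gt0//; near: n; exact: nbhs_infty_gt.
  have s'0 : s (sh n) != 0.
    rewrite gt_eqF// rsqrt_gt0// -(ltr0n R).
    have -> : (sh n)%:R = n%:R + e :> R by near: n.
    have : 2 <= n%:R :> R by near: n; exact: nbhs_infty_ger.
    by move: e_le1; rewrite ler_norml => /andP[]; lra.
  rewrite (horner_coef_wide _ sp) !big_ord_recr big_ord0 /=.
  by field; rewrite s0 s'0.
by do 6?[case=> [_|]//; first by rewrite /Rp; compute_coef; field].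
Unshelve. all: by end_near. Qed.

End Shift.

(** * The formal solution of Freud's equations *)

Section Approximants.
Variables (R : realType) (l t : R).
Local Notation s := (@rsqrt R).
Local Notation k := (Num.sqrt 6 : R).

(** The coefficient of index i belongs to n^((1-i)/2) in the formal series of
    gamma_(2n), and likewise below for gamma_(2n-1).  At each order they solve a
    linear system of matrix [[4, 2], [2, 4]] whose right-hand side depends on the
    earlier ones. *)
Definition gamma_even_coef : nat -> R := nth 0
  [:: k / 6; t / 12; k * (t ^+ 2 - 24 * l - 12) / 288;
      - (t * (1 + 2 * l) / 16);
      k * (336 - 264 * t ^+ 2 - t ^+ 4 + 1152 * l - 528 * l * t ^+ 2
           + 1152 * l ^+ 2) / (96 * 288);
      t * (28 - 9 * t ^+ 2 + 108 * l - 18 * l * t ^+ 2 + 108 * l ^+ 2) / 1152].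

Definition gamma_odd_coef : nat -> R := nth 0
  [:: k / 6; t / 12; k * (t ^+ 2 + 48 * l + 12) / 288;
      t * (1 + 2 * l) / 16;
      k * (336 + 264 * t ^+ 2 - t ^+ 4 + 576 * l + 480 * l * t ^+ 2
           - 576 * l ^+ 2) / (96 * 288);
      t * (28 + 9 * t ^+ 2 + 36 * l + 18 * l * t ^+ 2 - 36 * l ^+ 2) / 1152].

Local Notation A := (\poly_(i < 6) gamma_even_coef i).
Local Notation C := (\poly_(i < 6) gamma_odd_coef i).

Lemma sqr_sqrt6 : k ^+ 2 = 6.
Proof. by rewrite sqr_sqrtr. Qed.

(** The coefficient of index i belongs to n^((3-i)/2) in the expansion of
    p(n,t). *)
Definition subleading_coef : nat -> R := nth 0
  [:: - (2 * k / 9); - (t / 6); - (k * (t ^+ 2 + 12 * l) / 72);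
      - (t * (t ^+ 2 + 18 * l) / 216);
      - (k * (t ^+ 4 + 24 * l * t ^+ 2 - 288 * l ^+ 2 + 48) / (6 * 1152));
      t * (9 * l ^+ 2 - 2) / 144;
      k * (t ^+ 6 + 36 * l * t ^+ 4 + 144 * t ^+ 2 * (66 * l ^+ 2 - 17)
        - 1728 * l * (8 * l ^+ 2 - 1)) / (144 * 1152 * 6);
      t * (t ^+ 2 * (27 * l ^+ 2 - 7) + 12 * l * (2 - 9 * l ^+ 2)) / 3456].
Local Notation T := (\poly_(i < 8) subleading_coef i).

Arguments gamma_even_coef : simpl never.
Arguments gamma_odd_coef : simpl never.
Arguments subleading_coef : simpl never.
Ltac check_coefs := do ?[case=> [_|]//; first by
  compute_coef; cbv [gamma_even_coef gamma_odd_coef subleading_coef nth]; field: sqr_sqrt6].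

(** Freud's equation at index 2n for the truncated series, divided by n. *)
Lemma expands_residual_even : expands 6 (fun n =>
   2 * A.[s n] * (s n * (C.[s n.+1] / s n.+1) + A.[s n] + C.[s n] - t / 2 * s n) - 1) 0.
Proof.
have sh : \forall n \near \oo, n.+1%:R = n%:R + 1 :> R by apply: nearW => n; rewrite natr1.
have e1 : `|1 : R| <= 1 by rewrite normr1.
have Ap := expands_horner 6 A; have Cp := expands_horner 6 C.
have E := expandsB (expandsM (expandsZ 2 Ap)
  (expandsB (expandsD (expandsD (expands_shift e1 sh (size_poly 6 gamma_odd_coef)) Ap) Cp)
     (expandsZ (t / 2) (expands_horner 6 'X)))) (expands_horner 6 1).
apply: (eq_expands _ (expands_mod E _)).
  by apply: nearW => n; rewrite hornerX hornerC.
by check_coefs.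
Qed.

(** Freud's equation at index 2n - 1 for the truncated series, divided by n. *)
Lemma expands_residual_odd : expands 6 (fun n =>
   2 * C.[s n] * (s n * (A.[s n.-1] / s n.-1) + A.[s n] + C.[s n] - t / 2 * s n)
     - (1 + l * s n ^+ 2)) 0.
Proof.
have sh : \forall n \near \oo, n.-1%:R = n%:R + -1 :> R.
  near=> n; rewrite -[in RHS](@prednK n); last by near: n; exact: nbhs_infty_gt.
  by rewrite -natr1 addrK.
have e1 : `|-1 : R| <= 1 by rewrite normrN1.
have Ap := expands_horner 6 A; have Cp := expands_horner 6 C.
have E := expandsB (expandsM (expandsZ 2 Cp)
  (expandsB (expandsD (expandsD (expands_shift e1 sh (size_poly 6 gamma_even_coef)) Ap) Cp)
     (expandsZ (t / 2) (expands_horner 6 'X))))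
  (expandsD (expands_horner 6 1)
     (expandsZ l (expandsM (expands_horner 6 'X) (expands_horner 6 'X)))).
apply: (eq_expands _ (expands_mod E _)).
  by apply: nearW => n; rewrite hornerX hornerC expr2.
by check_coefs.
Unshelve. all: by end_near. Qed.

(** The expression of n^(-3/2) p(n,t) through u = n^(-1/2), x = u gamma_(2n) and
    y = u gamma_(2n-1). *)
Definition scaled_subleading (u x y : R) :=
  - y - (1 + l * u ^+ 2) * x + 2 * x * y * (x + y - t / 2 * u).

(** Six coefficients of each gamma determine eight of p(n,t): by the
    stationarity below, an error of order 6 in x and y has an effect of order
    8. *)
Lemma expands_scaled_subleading : expands 8 (fun n => scaled_subleading (s n) A.[s n] C.[s n]) T.
Proof.
have E := expands_horner 8 (- C - (1 + l *: ('X * 'X)) * A + 2 *: A * C * (A + C - (t / 2) *: 'X)).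
apply: (eq_expands _ (expands_mod E _)).
  by apply: nearW => n; rewrite !(hornerE, hornerM) /scaled_subleading /=; ring.
by check_coefs.
Qed.

(** The partial derivative in x of [scaled_subleading].  For an exact solution
    it is 2 y times u (gamma_(2n) - gamma_(2n-2)), hence of order u^2. *)
Lemma expands_scaled_subleading_dx : expands 2 (fun n =>
  - (1 + l * s n ^+ 2) + 4 * A.[s n] * C.[s n] + 2 * C.[s n] ^+ 2 - t * s n * C.[s n]) 0.
Proof.
have E := expands_horner 2 (- (1 + l *: ('X * 'X)) + 4 *: A * C + 2 *: (C * C) - t *: ('X * C)).
apply: (eq_expands _ (expands_mod E _)).
  by apply: nearW => n; rewrite !(hornerE, hornerM) /=; ring.
by check_coefs.
Qed.

(** The partial derivative in y, which for an exact solution is 2 x times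
    u (gamma_(2n-1) - gamma_(2n+1)). *)
Lemma expands_scaled_subleading_dy : expands 2 (fun n =>
  - 1 + 4 * A.[s n] * C.[s n] + 2 * A.[s n] ^+ 2 - t * s n * A.[s n]) 0.
Proof.
have E := expands_horner 2 (- 1 + 4 *: A * C + 2 *: (A * A) - t *: ('X * A)).
apply: (eq_expands _ (expands_mod E _)).
  by apply: nearW => n; rewrite !(hornerE, hornerM) /=; ring.
by check_coefs.
Qed.

Lemma subleading_expansionE n : (0 < n)%N -> subleading_expansion l t n = T.[s n] / s n ^+ 3.
Proof.
move=> n0; have N0 : 0 < n%:R :> R by rewrite ltr0n.
have s0 := rsqrt_gt0 R n0.
rewrite horner_poly !big_ord_recr big_ord0 /=.
rewrite /subleading_expansion; cbv [subleading_coef nth].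
have -> : Num.sqrt (2 / 3) = k / 3.
  apply/eqP; rewrite -(@eqrXn2 _ 2)// ?sqrtr_ge0 ?divr_ge0 ?sqrtr_ge0//.
  by rewrite exprMn !sqr_sqrtr ?divr_ge0//; apply/eqP; field.
rewrite sqrtrM//.
have -> : n%:R `^ (3 / 2) = (s n ^+ 3)^-1.
  rewrite /rsqrt exprVn invrK -powR12_sqrt ?ler0n// -powR_mulrn ?powR_ge0//.
  by rewrite -powRrM; congr (_ `^ _); field.
have -> : n%:R = (s n ^+ 2)^-1 by rewrite sqr_rsqrt invrK.
have -> : Num.sqrt (s n ^- 2) = (s n)^-1.
  by rewrite -exprVn sqrtr_sqr ger0_norm// invr_ge0 ltW.
have k0 : k != 0 by rewrite gt_eqF// sqrtr_gt0.
by field: sqr_sqrt6; rewrite k0 gt_eqF.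
Qed.

End Approximants.

(** * Comparing the positive solution with the formal one *)

Section Contraction.
Variable R : realType.
Local Notation s := (@rsqrt R).

Lemma expandsM0 K J (f g : nat -> R) : expands K f 0 -> expands J g 0 ->
  expands (K + J) (fun n => f n * g n) 0.
Proof.
move=> [C fC] [D gD]; exists (C * D); apply: filterS2 fC gD => n.
by rewrite horner0 !subr0 normrM exprD mulrACA => fn gn; rewrite ler_pM.
Qed.

(** Here x is the error of an approximate solution y of Freud's equation, S the
    bracket of the exact one, Z the sum of the errors at the two neighbours and u
    is n^(-1/2).  The bounds give y <= 2/3 S, hence the factor
    y / (S + y) <= 2/5. *)
Lemma contraction_step (x S y Z eps M u : R) : 0 < u ->
  x * (S + y) = - eps - y * Z -> 5 / 8 <= u * S -> 0 <= y -> u * y <= 5 / 12 ->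
  `|eps| <= M * u ^+ 4 -> `|x| <= 2 / 5 * `|Z| + 2 * M * u ^+ 5.
Proof.
move=> u0 E uS y0 uy eM.
have Sy : 0 < u * (S + y) by rewrite mulrDr; have := mulr_ge0 (ltW u0) y0; lra.
have uy0 := mulr_ge0 (ltW u0) y0.
have xE : `|x| * (u * (S + y)) <= u * `|eps| + u * y * `|Z|.
  have -> : `|x| * (u * (S + y)) = `|x * (u * (S + y))| by rewrite normrM [`|u * _|]gtr0_norm.
  have -> : x * (u * (S + y)) = u * (x * (S + y)) by ring.
  rewrite E -opprD mulrN normrN normrM gtr0_norm// -mulrA -mulrDr ler_wpM2l ?(ltW u0)//.
  by rewrite (le_trans (ler_normD _ _))// [`|y * Z|]normrM ger0_norm.
have epsM : u * `|eps| <= M * u ^+ 5.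
  by rewrite (_ : M * u ^+ 5 = u * (M * u ^+ 4)) ?ler_wpM2l ?(ltW u0)//; ring.
have Mu : 0 <= M * u ^+ 5.
  by rewrite (le_trans _ epsM)// mulr_ge0// ltW.
have Z0 := normr_ge0 Z; have x0 := normr_ge0 x.
set w := u * (S + y) in Sy xE *; have wE : w = u * S + u * y by rewrite /w mulrDr.
have yw : u * y <= 2 / 5 * w by lra.
have w58 : 5 / 8 <= w by lra.
rewrite -(ler_pM2r Sy) (le_trans xE)// [X in _ <= X]mulrDl [X in _ <= X]addrC lerD//.
  rewrite (le_trans epsM)//.
  have : (2 * w - 1) * (M * u ^+ 5) >= 0 by rewrite mulr_ge0//; lra.
  by lra.
by rewrite [X in _ <= X]mulrAC ler_wpM2r.
Qed.

Lemma near_eventually (Pr : nat -> Prop) : (\forall n \near \oo, Pr n) ->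
  exists N, forall n, (N <= n)%N -> Pr n.
Proof. by case=> N _ H; exists N => n /H. Qed.

(** The inequality bounds a by about sqrt (n / 2), and 1 / sqrt 2 < 4/5. *)
Lemma a_priori_bound (l t : R) : \forall n \near \oo,
  forall a, 0 < a -> 2 * a * (a - t / 2) <= n%:R + l -> s n * a <= 4 / 5.
Proof.
near=> n => a a0 Ha.
have n0 : (0 < n)%N by near: n; exact: nbhs_infty_gt.
have s0 := rsqrt_gt0 R n0; have s1 := rsqrt_le1 R n.
have : s n <= 1 / (10 * (1 + `|t| + `|l|)).
  by near: n; apply: rsqrt_small; rewrite divr_gt0// mulr_gt0.
have t0 := normr_ge0 t; have l0 := normr_ge0 l.
have tt := ler_norm t; have ll := ler_norm l.
rewrite ler_pdivlMr; last by lra.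
move=> small.
have st : s n * `|t| <= 1 / 10.
  by have := mulr_ge0 (ltW s0) l0; lra.
have sl : s n * `|l| <= 1 / 10.
  by have := mulr_ge0 (ltW s0) t0; lra.
have nE : n%:R * s n ^+ 2 = 1 by rewrite sqr_rsqrt mulfV// pnatr_eq0 -lt0n.
have : s n ^+ 2 * (2 * a * (a - t / 2)) <= s n ^+ 2 * (n%:R + l) by rewrite ler_wpM2l// sqr_ge0.
set x := s n * a; have x0 : 0 < x by rewrite mulr_gt0.
have -> : s n ^+ 2 * (2 * a * (a - t / 2)) = 2 * x ^+ 2 - x * (s n * t) by rewrite /x; field.
have -> : s n ^+ 2 * (n%:R + l) = 1 + s n * (s n * l) by rewrite mulrDr [_ * n%:R]mulrC nE; ring.
have : s n * t <= 1 / 10 by rewrite (le_trans _ st)// ler_wpM2l// ltW.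
have : s n * (s n * l) <= 1 / 10.
  apply: (@le_trans _ _ (s n * (s n * `|l|))); first by rewrite !ler_wpM2l// ltW.
  by rewrite (le_trans _ sl)// ler_piMl// mulr_ge0// ltW.
move=> h1 h2 h3; rewrite leNgt; apply/negP => x45; nra.
Unshelve. all: by end_near. Qed.

(** The sequence n^(-5/2) satisfies the hypothesis of the barrier. *)
Lemma rsqrt_step : \forall n \near \oo,
  s n.-1 ^+ 5 <= 5 / 4 * s n ^+ 5 /\ s n.+1 ^+ 5 <= 5 / 4 * s n ^+ 5.
Proof.
near=> n.
have n0 : (30 < n)%N by near: n; exact: nbhs_infty_gt.
have s0 : 0 < s n by rewrite rsqrt_gt0// (leq_trans _ n0).
have mono m k : (0 < m <= k)%N -> s k <= s m.
  move=> /andP[m0 mk]; rewrite lef_pV2 ?posrE ?sqrtr_gt0 ?ltr0n// ?(leq_trans m0)//.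
  by rewrite ler_sqrt ?ltr0n ?ler_nat// (leq_trans m0).
split; last first.
  have : s n.+1 ^+ 5 <= s n ^+ 5.
    by rewrite lerXn2r ?nnegrE ?rsqrt_ge0// mono// leqnSn (leq_trans _ n0).
  by have := exprn_gt0 5 s0; lra.
have n1 : (0 < n.-1)%N by rewrite -ltnS (ltn_predK n0) (leq_trans _ n0).
have p0 : 0 < s n.-1 by rewrite rsqrt_gt0.
have step : s n.-1 <= 26 / 25 * s n.
  rewrite -(@ler_pXn2r _ 2)// ?nnegrE ?(ltW p0) ?mulr_ge0 ?(ltW s0)//.
  rewrite exprMn !sqr_rsqrt ler_pdivlMr ?ltr0n ?(leq_trans _ n0)// mulrC.
  rewrite ler_pdivrMr ?ltr0n//.
  have : n%:R = n.-1%:R + 1 :> R by rewrite natr1 (ltn_predK n0).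
  have : 30 <= n.-1%:R :> R by rewrite ler_nat -ltnS (ltn_predK n0).
  by move=> h ->; lra.
have : s n.-1 ^+ 5 <= (26 / 25 * s n) ^+ 5.
  by rewrite lerXn2r// ?nnegrE ?(ltW p0)// mulr_ge0 ?(ltW s0).
rewrite exprMn; have := exprn_gt0 5 s0.
set v := s n ^+ 5 => v0; have : (26 / 25 : R) ^+ 5 <= 5 / 4 by lra.
nra.
Unshelve. all: by end_near. Qed.

End Contraction.

Lemma drop_nonneg (R : realFieldType) (x y z u N : R) : 0 < x -> 0 <= y -> 0 <= z ->
  2 * x * (y + x + z - u) = N -> 2 * x * (x - u) <= N.
Proof. by move=> x0 y0 z0 <-; rewrite ler_wpM2l ?mulr_ge0 ?(ltW x0)//; lra. Qed.

Section FreudSolution.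
Variables (R : realType) (l t : R).
Local Notation s := (@rsqrt R).
Hypothesis l_ge0 : 0 <= l.
Variables (a c : nat -> R).
Hypothesis a_gt0 : forall n, 0 < a n.+1.
Hypothesis c_gt0 : forall n, 0 < c n.+1.
Hypothesis freud_a : forall n,
  2 * a n.+1 * (c n.+2 + a n.+1 + c n.+1 - t / 2) = n.+1%:R.
Hypothesis freud_c : forall n,
  2 * c n.+2 * (a n.+2 + c n.+2 + a n.+1 - t / 2) = n.+2%:R + l.

Local Notation A := (\poly_(i < 6) gamma_even_coef l t i).
Local Notation C := (\poly_(i < 6) gamma_odd_coef l t i).
Definition approx (p : {poly R}) n := p.[s n] / s n.

(** The bound 5/12 lies above the leading coefficient 1 / sqrt 6 of the formal
    solution and is 2/3 of the lower bound 5/8 for the bracket, as the contraction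
    requires. *)
Lemma approx_upper (p : {poly R}) : 1 / 120 <= p`_0 <= 49 / 120 ->
  \forall n \near \oo, 0 <= approx p n /\ s n * approx p n <= 5 / 12.
Proof.
move=> /andP[p1 p2].
have [M M0 pM] : exists2 M, 0 <= M & \forall n \near \oo, `|p.[s n] - p`_0| <= M * s n.
  have : expands 1 (fun n => p.[s n]) (p`_0)%:P.
    by apply: (expands_mod (expands_horner 1 p)) => -[|//] _; rewrite coefC.
  by move=> /expandsP[M M0 pM]; exists M => //; apply: filterS pM => n; rewrite hornerC.
have M1 : 0 < 120 * (1 + M) by rewrite mulr_gt0// ltr_wpDr.
near=> n.
have s0 : 0 < s n by rewrite rsqrt_gt0//; near: n; exact: nbhs_infty_gt.
have h3 : s n <= 1 / (120 * (1 + M)) by near: n; apply: rsqrt_small; rewrite divr_gt0.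
have hp : `|p.[s n] - p`_0| <= M * s n by near: n.
have Ms : 0 <= M * s n by rewrite mulr_ge0 // ltW.
rewrite /approx [s n * _]mulrC mulfVK ?gt_eqF//.
move: h3 hp; rewrite ler_pdivlMr// ler_norml.
move: p.[s n] p`_0 p1 p2 (s n) s0 Ms => y y0 p1 p2 u u0 Ms h3 /andP[h1 h2].
by split; [rewrite divr_ge0 ?(ltW u0)//|]; lra.
Unshelve. all: by end_near. Qed.

Lemma sqrt6_bounds : 1 / 120 <= (Num.sqrt 6 : R) / 6 <= 49 / 120.
Proof.
have k1 : Num.sqrt 6 <= 49 / 20 :> R.
  by rewrite -(@ler_pXn2r _ 2)// ?nnegrE ?divr_ge0// sqr_sqrtr//; lra.
have k2 : 1 <= Num.sqrt 6 :> R.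
  by rewrite -(@ler_pXn2r _ 2)// ?nnegrE// sqr_sqrtr//; lra.
by move: (Num.sqrt 6) k1 k2 => k k1 k2; apply/andP; split; lra.
Qed.

Definition gap n := Num.max `|a n - approx A n| `|c n - approx C n|.

(** Positivity of the neighbours turns Freud's equation into the inequality of
    [a_priori_bound]. *)
Lemma a_upper : \forall n \near \oo, s n * a n <= 4 / 5.
Proof.
near=> n; have n0 : (0 < n)%N by near: n; exact: nbhs_infty_gt.
have apr : forall a, 0 < a -> 2 * a * (a - t / 2) <= n%:R + l -> s n * a <= 4 / 5.
  by near: n; exact: a_priori_bound.
move: apr; rewrite -(prednK n0) => apr; apply: apr => //.
rewrite (le_trans (drop_nonneg _ (ltW (c_gt0 n.-1.+1)) (ltW (c_gt0 n.-1)) (freud_a _)))//.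
by rewrite lerDl.
Unshelve. all: by end_near. Qed.

Lemma c_upper : \forall n \near \oo, s n * c n <= 4 / 5.
Proof.
near=> n; have n0 : (1 < n)%N by near: n; exact: nbhs_infty_gt.
have apr : forall a, 0 < a -> 2 * a * (a - t / 2) <= n%:R + l -> s n * a <= 4 / 5.
  by near: n; exact: a_priori_bound.
have nE : n = n.-2.+2 by move: (n) n0 => [|[]].
move: apr; rewrite nE => apr; apply: apr => //.
exact: (drop_nonneg _ (ltW (a_gt0 n.-2.+1)) (ltW (a_gt0 n.-2)) (freud_c _)).
Unshelve. all: by end_near. Qed.

(** The bracket S equals N / (2 x), and 5/8 is the inverse of 2 * 4/5. *)
Lemma bracket_lower n (x S N : R) : (0 < n)%N -> 0 < x -> s n * x <= 4 / 5 ->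
  n%:R <= N -> 2 * x * S = N -> 5 / 8 <= s n * S.
Proof.
move=> n0 x0 sx nN SN; have s0 := rsqrt_gt0 R n0.
have nE : n%:R * s n ^+ 2 = 1 by rewrite sqr_rsqrt mulfV// pnatr_eq0 -lt0n.
have h : 1 <= 2 * (s n * x) * (s n * S).
  rewrite (_ : 2 * _ * _ = N * s n ^+ 2); last by rewrite -SN; ring.
  by rewrite -nE ler_wpM2r// sqr_ge0.
have sx0 : 0 < s n * x by rewrite mulr_gt0.
nra.
Qed.

Lemma residual_bound (E : nat -> R) : expands 6 (fun n => s n ^+ 2 * E n) 0 ->
  exists M, \forall n \near \oo, `|E n / 2| <= M * s n ^+ 4.
Proof.
move=> [M EM]; exists M; near=> n.
have s0 : 0 < s n by rewrite rsqrt_gt0//; near: n; exact: nbhs_infty_gt.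
have : `|s n ^+ 2 * E n - 0.[s n]| <= M * s n ^+ 6 by near: n.
rewrite horner0 subr0 normrM ger0_norm ?sqr_ge0//.
rewrite (_ : M * s n ^+ 6 = s n ^+ 2 * (M * s n ^+ 4)); last by ring.
rewrite ler_pM2l ?exprn_gt0// => h.
rewrite normrM [`|2^-1|]ger0_norm ?invr_ge0//.
by have := normr_ge0 (E n); lra.
Unshelve. all: by end_near. Qed.

Lemma gap_even : exists M, \forall n \near \oo,
  `|a n - approx A n| <= 2 / 5 * (gap n + gap n.+1) + M * s n ^+ 5.
Proof.
pose E n := 2 * approx A n * (approx C n.+1 + approx A n + approx C n - t / 2) - n%:R.
have [M EM] : exists M, \forall n \near \oo, `|E n / 2| <= M * s n ^+ 4.
  apply: residual_bound; apply: (eq_expands _ (expands_residual_even l t)).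
  near=> n; have n0 : (0 < n)%N by near: n; exact: nbhs_infty_gt.
  have s0 := rsqrt_gt0 R n0; have s1 := rsqrt_gt0 R (ltn0Sn n).
  have nE : s n ^+ 2 * n%:R = 1 by rewrite sqr_rsqrt mulVf// pnatr_eq0 -lt0n.
  by rewrite /E [RHS]mulrBr nE /approx; field; rewrite !gt_eqF.
exists (2 * M); near=> n.
have n0 : (0 < n)%N by near: n; exact: nbhs_infty_gt.
have s0 := rsqrt_gt0 R n0.
have [A0 A1] : 0 <= approx A n /\ s n * approx A n <= 5 / 12.
  by near: n; apply: approx_upper; rewrite coef_poly; exact: sqrt6_bounds.
have an : 0 < a n by rewrite -(prednK n0).
have ev : 2 * a n * (c n.+1 + a n + c n - t / 2) = n%:R by rewrite -(prednK n0) freud_a.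
have sa : s n * a n <= 4 / 5 by near: n; exact: a_upper.
have S58 := bracket_lower n0 an sa (lexx _) ev.
have En : `|E n / 2| <= M * s n ^+ 4 by near: n.
have := @contraction_step R (a n - approx A n) (c n.+1 + a n + c n - t / 2) (approx A n)
  ((c n.+1 - approx C n.+1) + (c n - approx C n)) (E n / 2) M (s n) s0 _ S58 A0 A1 En.
move=> /(_ _)/le_trans; apply.
  by rewrite /E -ev; field.
rewrite lerD2r ler_wpM2l// (le_trans (ler_normD _ _))// addrC lerD//.
  by rewrite le_max lexx orbT.
by rewrite le_max lexx orbT.
Unshelve. all: by end_near. Qed.

Lemma gap_odd : exists M, \forall n \near \oo,
  `|c n - approx C n| <= 2 / 5 * (gap n + gap n.-1) + M * s n ^+ 5.
Proof.
pose E n := 2 * approx C n * (approx A n.-1 + approx A n + approx C n - t / 2) - (n%:R + l).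
have [M EM] : exists M, \forall n \near \oo, `|E n / 2| <= M * s n ^+ 4.
  apply: residual_bound; apply: (eq_expands _ (expands_residual_odd l t)).
  near=> n; have n0 : (1 < n)%N by near: n; exact: nbhs_infty_gt.
  have s0 := rsqrt_gt0 R (ltnW n0).
  have s1 : 0 < s n.-1 by rewrite rsqrt_gt0// -ltnS (ltn_predK n0).
  have nE : s n ^+ 2 * n%:R = 1 by rewrite sqr_rsqrt mulVf// pnatr_eq0 -lt0n ltnW.
  by rewrite /E [RHS]mulrBr [X in _ = _ - X]mulrDr nE /approx; field; rewrite !gt_eqF.
exists (2 * M); near=> n.
have n1 : (1 < n)%N by near: n; exact: nbhs_infty_gt.
have n0 := ltnW n1.
have s0 := rsqrt_gt0 R n0.
have [A0 A1] : 0 <= approx C n /\ s n * approx C n <= 5 / 12.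
  by near: n; apply: approx_upper; rewrite coef_poly; exact: sqrt6_bounds.
have cn : 0 < c n by rewrite -(prednK n0).
have ev : 2 * c n * (a n + c n + a n.-1 - t / 2) = n%:R + l.
  by move: (n) n1 => [|[|m]]// _; rewrite freud_c.
have sc : s n * c n <= 4 / 5 by near: n; exact: c_upper.
have nl : n%:R <= n%:R + l by rewrite lerDl.
have S58 := bracket_lower n0 cn sc nl ev.
have En : `|E n / 2| <= M * s n ^+ 4 by near: n.
have := @contraction_step R (c n - approx C n) (a n + c n + a n.-1 - t / 2) (approx C n)
  ((a n - approx A n) + (a n.-1 - approx A n.-1)) (E n / 2) M (s n) s0 _ S58 A0 A1 En.
move=> /(_ _)/le_trans; apply.
  by rewrite /E -ev; field.
rewrite lerD2r ler_wpM2l// (le_trans (ler_normD _ _))// lerD//.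
  by rewrite le_max lexx.
by rewrite le_max lexx.
Unshelve. all: by end_near. Qed.

Lemma gap_linear : \forall n \near \oo, gap n <= 1 * n%:R.
Proof.
near=> n; have n0 : (0 < n)%N by near: n; exact: nbhs_infty_gt.
have s0 := rsqrt_gt0 R n0; have s1 := rsqrt_le1 R n.
have bnd x y : 0 < x -> 0 <= y -> s n * x <= 4 / 5 -> s n * y <= 5 / 12 ->
    `|x - y| <= 1 * n%:R.
  move=> x0 y0 sx sy; rewrite mul1r -(ler_pM2l s0).
  rewrite -[s n in X in X <= _](gtr0_norm s0) -normrM mulrBr.
  have sn : 1 <= s n * n%:R.
    have nE : s n ^+ 2 * n%:R = 1 by rewrite sqr_rsqrt mulVf// pnatr_eq0 -lt0n.
    by rewrite -[X in X <= _]nE ler_wpM2r// expr2 ler_piMl// ltW.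
  rewrite (le_trans _ sn)// ler_norml.
  have := mulr_gt0 s0 x0; have := mulr_ge0 (ltW s0) y0; lra.
have [A0 A1] : 0 <= approx A n /\ s n * approx A n <= 5 / 12.
  by near: n; apply: approx_upper; rewrite coef_poly; exact: sqrt6_bounds.
have [C0 C1] : 0 <= approx C n /\ s n * approx C n <= 5 / 12.
  by near: n; apply: approx_upper; rewrite coef_poly; exact: sqrt6_bounds.
rewrite ge_max; apply/andP; split; apply: bnd => //.
- by rewrite -(prednK n0).
- by near: n; exact: a_upper.
- by rewrite -(prednK n0).
- by near: n; exact: c_upper.
Unshelve. all: by end_near. Qed.

(** In [gap_even] and [gap_odd] the gap at n itself occurs on the right; moving it
    to the left turns the factor 2/5 into 2/3. *)
Lemma gap_decay : exists K, \forall n \near \oo, gap n <= K * s n ^+ 5.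
Proof.
have [M1 ev] := gap_even; have [M2 od] := gap_odd.
pose M := Num.max `|M1| `|M2|.
have [N HN] : exists N, forall n, (N <= n)%N ->
  [/\ gap n <= 2 / 3 * Num.max (gap n.-1) (gap n.+1) + 5 / 3 * M * s n ^+ 5,
      s n.-1 ^+ 5 <= 5 / 4 * s n ^+ 5, s n.+1 ^+ 5 <= 5 / 4 * s n ^+ 5 &
      gap n <= 1 * n%:R].
  apply: near_eventually; near=> n.
  have [? ?] : s n.-1 ^+ 5 <= 5 / 4 * s n ^+ 5 /\ s n.+1 ^+ 5 <= 5 / 4 * s n ^+ 5.
    by near: n; exact: rsqrt_step.
  split => //; last by near: n; exact: gap_linear.
  have s5 : 0 <= s n ^+ 5 by rewrite exprn_ge0// rsqrt_ge0.
  have h1 : `|a n - approx A n| <= 2 / 5 * (gap n + gap n.+1) + M1 * s n ^+ 5 by near: n.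
  have h2 : `|c n - approx C n| <= 2 / 5 * (gap n + gap n.-1) + M2 * s n ^+ 5 by near: n.
  have m1 : M1 * s n ^+ 5 <= M * s n ^+ 5.
    by rewrite ler_wpM2r// le_max ler_norm.
  have m2 : M2 * s n ^+ 5 <= M * s n ^+ 5.
    by rewrite ler_wpM2r// le_max ler_norm orbT.
  set V := Num.max (gap n.-1) (gap n.+1).
  have V1 : gap n.-1 <= V by rewrite le_max lexx.
  have V2 : gap n.+1 <= V by rewrite le_max lexx orbT.
  have : gap n <= 2 / 5 * (gap n + V) + M * s n ^+ 5.
    by rewrite [X in X <= _]/gap ge_max; apply/andP; split; lra.
  by lra.
have [K HK] : exists K, forall n, (N.+1 <= n)%N -> gap n <= K * s n ^+ 5.
  apply: (@barrier_decay R gap (fun n => s n ^+ 5) N.+1 1 (5 / 3 * M)) => n Nn.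
  - by rewrite exprn_gt0// rsqrt_gt0// (leq_trans _ Nn).
  - by have [] := HN n (ltnW (ltnW Nn)).
  - by have [] := HN n (ltnW (ltnW Nn)).
  - by have [] := HN n (ltnW Nn).
by exists K; exists N.+1 => // n; exact: HK.
Unshelve. all: by end_near. Qed.

Lemma expands_scaled (x : nat -> R) p :
  (exists K, \forall n \near \oo, `|x n - approx p n| <= K * s n ^+ 5) ->
  expands 6 (fun n => s n * x n) p.
Proof.
move=> [K xK]; exists K; near=> n.
have s0 : 0 < s n by rewrite rsqrt_gt0//; near: n; exact: nbhs_infty_gt.
have -> : s n * x n - p.[s n] = s n * (x n - approx p n) by rewrite /approx; field; rewrite gt_eqF.
rewrite normrM gtr0_norm// (_ : K * s n ^+ 6 = s n * (K * s n ^+ 5)); last by ring.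
by rewrite ler_wpM2l ?(ltW s0)//; near: n.
Unshelve. all: by end_near. Qed.

Lemma expands_gamma_even : expands 6 (fun n => s n * a n) A.
Proof.
apply: expands_scaled; have [K gK] := gap_decay; exists K; apply: filterS gK => n.
by apply: le_trans; rewrite le_max lexx.
Qed.

Lemma expands_gamma_odd : expands 6 (fun n => s n * c n) C.
Proof.
apply: expands_scaled; have [K gK] := gap_decay; exists K; apply: filterS gK => n.
by apply: le_trans; rewrite le_max lexx orbT.
Qed.

Local Notation T := (\poly_(i < 8) subleading_coef l t i).

(** Taylor's formula at the truncated series.  The errors of x and y are of
    order 6: the linear terms gain two orders from the stationarity, the quadratic
    and cubic ones are of order at least 12. *)
Lemma expands_scaled_subleading_solution :
  expands 8 (fun n => scaled_subleading l t (s n) (s n * a n) (s n * c n)) T.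
Proof.
have diff0 x p : expands 6 x p -> expands 6 (fun n => x n - p.[s n]) 0.
  by move=> xp; rewrite -[X in expands _ _ X](subrr p); apply: expandsB xp (expands_horner _ _).
have da := diff0 _ _ expands_gamma_even; have dc := diff0 _ _ expands_gamma_odd.
have w (f : nat -> R) J : (8 <= J)%N -> expands J f 0 -> expands 8 f 0 by exact: expands_weaken.
have Ap := expands_horner 8 A; have Cp := expands_horner 8 C.
have E1 := expandsM0 da (expands_scaled_subleading_dx l t).
have E2 := expandsM0 dc (expands_scaled_subleading_dy l t).
have E3 := expandsM Cp (w _ 12%N isT (expandsM0 da da)).
have E4 := expandsM Ap (w _ 12%N isT (expandsM0 dc dc)).
have E5 := expandsM (expandsB (expandsD (expandsZ 4 Ap) (expandsZ 4 Cp))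
   (expandsZ t (expands_horner 8 'X)))
   (w _ 12%N isT (expandsM0 da dc)).
have E6 := w _ 18%N isT (expandsM0 da (expandsM0 da dc)).
have E7 := w _ 18%N isT (expandsM0 da (expandsM0 dc dc)).
have E := expandsD (expandsD (expandsD (expandsD (expandsD (expandsD (expandsD
  (expands_scaled_subleading l t) E1) E2) (expandsZ 2 E3)) (expandsZ 2 E4)) E5)
  (expandsZ 2 E6)) (expandsZ 2 E7).
rewrite !(mulr0, scaler0, addr0) in E.
apply: eq_expands E; apply: nearW => n; rewrite hornerX /scaled_subleading.
move: A.[s n] C.[s n] => x y; by field.
Qed.

End FreudSolution.

(** * The expansion *)

Lemma powR_rsqrt (R : realType) n : (n%:R : R) `^ (- (5 / 2)) = rsqrt R n ^+ 5.
Proof.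
rewrite /rsqrt exprVn -powR12_sqrt ?ler0n// -powR_mulrn ?powR_ge0// powRN.
by congr (_^-1); rewrite -powRrM; congr (_ `^ _); field.
Qed.

Theorem theorem1p7 (R : realType) (lambda t : R) (lambda_gt0 : 0 < lambda)
    (P : nat -> {poly R}) (h : nat -> R)
    (hP : monic_orthogonal lambda t P h) :
  subleading P = subleading_expansion lambda t
    +O_\oo (fun n : nat => (n%:R : R) `^ (- (5 / 2))).
Proof.
case: hP => hP orth.
have P_monic n : P n \is monic by have [] := hP n.
have size_P n : size (P n) = n.+1 by have [] := hP n.
pose L := moment_linear t lambda_gt0.
have P_orth m n : L (P m * P n) = if m == n then h n else 0.
  rewrite /L /= /moment /Rintegral.
  under eq_integral do rewrite hornerM.
  by rewrite orth.
have L_pearson := moment_pearson t lambda_gt0 : forall p, L _ = 0.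
have L_gt0 := moment_gt0 t lambda_gt0 : forall p, _ -> _ -> 0 < L p.
pose a := gamma_even P h; pose c := gamma_odd P.
have [M EM] : expands 8 (fun n =>
      scaled_subleading lambda t (rsqrt R n) (rsqrt R n * a n) (rsqrt R n * c n))
    (\poly_(i < 8) subleading_coef lambda t i).
  apply: (@expands_scaled_subleading_solution R lambda t (ltW lambda_gt0) a c) => n.
  - exact: (gamma_even_gt0 L_gt0 P_monic size_P P_orth).
  - exact: (gamma_odd_gt0 L_gt0 P_monic size_P P_orth).
  - exact: (freud_even L_pearson L_gt0 P_monic size_P P_orth).
  - exact: (freud_odd L_pearson L_gt0 P_monic size_P P_orth).
apply/eqaddOP/bigO_exP; exists (Num.max 1 M).
  by rewrite lt_max ltr01.
near=> n.
have n1 : (1 < n)%N by near: n; exact: nbhs_infty_gt.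
have s0 : 0 < rsqrt R n by rewrite rsqrt_gt0// ltnW.
have : `|scaled_subleading lambda t (rsqrt R n) (rsqrt R n * a n) (rsqrt R n * c n)
  - (\poly_(i < 8) subleading_coef lambda t i).[rsqrt R n]| <= M * rsqrt R n ^+ 8 by near: n.
rewrite /= powR_rsqrt [`|rsqrt R n ^+ 5|]ger0_norm ?exprn_ge0 ?(ltW s0)//.
have -> : (subleading P - subleading_expansion lambda t) n =
   subleading P n - subleading_expansion lambda t n by [].
rewrite subleading_expansionE ?(ltnW n1)//.
have -> : scaled_subleading lambda t (rsqrt R n) (rsqrt R n * a n) (rsqrt R n * c n) =
   rsqrt R n ^+ 3 * subleading P n.
  have nE : rsqrt R n ^+ 2 * n%:R = 1 by rewrite sqr_rsqrt mulVf// pnatr_eq0 -lt0n ltnW.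
  have -> : subleading P n =
      - n%:R * c n - (n%:R + lambda) * a n + 2 * a n * c n * (a n + c n - t / 2).
    move: (n) n1 => [|[|m]]// _.
    exact: (subleading_gamma L_pearson L_gt0 P_monic size_P P_orth).
  by rewrite /scaled_subleading; field: nE.
set p := subleading P n; set T := horner _ _ => hM.
have -> : p - T / rsqrt R n ^+ 3 = (rsqrt R n ^+ 3 * p - T) / rsqrt R n ^+ 3.
  by field; rewrite gt_eqF.
rewrite normrM [`|_^-1|]gtr0_norm ?invr_gt0 ?exprn_gt0// ler_pdivrMr ?exprn_gt0//.
rewrite (le_trans hM)// -mulrA -exprD ler_wpM2r ?exprn_ge0 ?(ltW s0)//.
by rewrite le_max lexx orbT.
Unshelve. all: by end_near. Qed.
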